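(* There is an effective constant $N$ such that for all integers $n\ge N$ and all finite nonempty sets $A\subseteq\mathbb{N}$, $$|A\,\Delta\,(2\cdot A)\,\Delta\cdots\Delta\,(n\cdot A)|\ge n.$$ One may in particular take $N=2\cdot(3^{80}-321)$; that is, the inequality holds for every integer $n\ge 2\cdot(3^{80}-321)$ and every finite nonempty $A\subseteq\mathbb{N}$.
   Context: $\mathbb{N}=\{1,2,3,\dots\}$. For $a\in\mathbb{N}$ and $B\subseteq\mathbb{N}$, $a\cdot B=\{ab:b\in B\}$. $\Delta$ denotes symmetric difference of sets; $A\,\Delta\,(2\cdot A)\,\Delta\cdots\Delta\,(n\cdot A)$ is the set of positive integers lying in an odd number of the sets $1\cdot A, 2\cdot A,\dots,n\cdot A$. *)

(* Defs.v *)
From HB Require Import structures.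
From mathcomp Require Import all_boot finmap.

Set Implicit Arguments.
Unset Strict Implicit.
Unset Printing Implicit Defensive.

Local Open Scope fset_scope.

Definition dilate (k : nat) (A : {fset nat}) : {fset nat} :=
  [fset k * a | a in A]%N.

Definition symdiff (A B : {fset nat}) : {fset nat} :=
  (A `\` B) `|` (B `\` A).

Definition symdiff_dilates (n : nat) (A : {fset nat}) : {fset nat} :=
  \big[symdiff/fset0]_(1 <= k < n.+1) dilate k A.

Lemma in_symdiff (A B : {fset nat}) (x : nat) :
  (x \in symdiff A B) = (x \in A) (+) (x \in B).
Proof. by rewrite !inE; case: (x \in A); case: (x \in B). Qed.

Lemma symdiffA : associative symdiff.
Proof. by move=> A B C; apply/fsetP => x; rewrite !in_symdiff addbA. Qed.

Lemma symdiffC : commutative symdiff.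
Proof. by move=> A B; apply/fsetP => x; rewrite !in_symdiff addbC. Qed.

Lemma symdiff0s : left_id fset0 symdiff.
Proof. by move=> A; apply/fsetP => x; rewrite in_symdiff in_fset0. Qed.

HB.instance Definition _ :=
  Monoid.isComLaw.Build {fset nat} fset0 symdiff symdiffA symdiffC symdiff0s.

Lemma in_symdiff_dilates (n : nat) (A : {fset nat}) (x : nat) :
  (x \in symdiff_dilates n A) =
  odd (count (fun k => x \in dilate k A) (iota 1 n)).
Proof.
rewrite /symdiff_dilates /index_iota subn1 /=.
elim: (iota 1 n) => [|k s IHs]; first by rewrite big_nil in_fset0.
by rewrite big_cons in_symdiff IHs /= oddD oddb.
Qed.

(* Main.v *)
Require Import Defs.
From HB Require Import structures.
From mathcomp Require Import all_boot all_order all_algebra finmap.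
From mathcomp Require Import ring lra zify.
From mathcomp.multinomials Require Import monalg.

Set Implicit Arguments.
Unset Strict Implicit.
Unset Printing Implicit Defensive.

Import Order.TTheory GRing.Theory Num.Theory.

Local Open Scope fset_scope.
Local Open Scope ring_scope.

(** Work in the ring R of the multiplicative monoid of positive integers over
    the field with two elements.  A finite set of positive integers is an element of R, symmetric
    difference is addition, and the set to be bounded from below is f * A with
    f = 1 + 2 + ... + n (a formal sum, [segment n]).  Writing [wt] for the number
    of terms, the claim is that wt (f * A) >= n for A <> 0.  Suppose not, and
    choose A with L = wt (f * A) < n minimal and, among those, with minimal
    largest term.

    Derivations.  Let P be the set of primes in (n/2, n].  A prime p induces a
    derivation [pderiv p] of R, and it maps f to 1 when p is in P, because p is
    then the only term of f with odd p-valuation.  Hence the difference of two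
    such derivations commutes with multiplication by f, and minimality of A
    forces [pderiv p A] to be one and the same K for all p in P ([pderiv_eq]).
    Consequently H = pderiv p (f * A) = A + f * K is also independent of p, which
    puts |P| disjoint copies of H inside f * A.  If K were nonzero, extracting the
    terms that are perfect squares from a multiple of f * A = f * H + f^2 * K
    would give a square (f * k)^2 up to an error of wt H * sqrt n, and since
    |P| > sqrt n the element k would be a smaller multiplier.  So K = 0, A = H, and s = wt A satisfies
    s * |P| <= L ([few_terms]).  As L < n and |P| is at least about n / (3 log2 n),
    A has few terms.

    Splitting.  If a prime p divides some term of A, it does not divide all of
    them by minimality of A; the two halves of A, divisible and not divisible by
    p, are both nonzero, hence each has a multiple of weight at least L, and this
    yields p * L <= 2 * n * s ([two_halves]).  On the other hand, let q be the
    largest prime dividing a term of A.  Sorting the terms of f by their part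
    prime to all primes <= q decomposes f * A into disjoint products of A with the
    classes [rough_class n q m], and each class contributes at least s, 4 or 6
    terms according to the size of m (fewer for q = 2, 3).  Both estimates are collected in
    [multiplier_data]; they only involve n, s, q, L and the numbers Phi q x of
    integers up to x without prime factor <= q.

    Arithmetic.  A lower bound for |P| in the style of Erdos gives
    q <= 6 * (l + 1) for 2^l <= n < 2^(l+1), so q is tiny compared to n and the
    Legendre sieve evaluates Phi q x up to a negligible error
    ([sieve_bounds]).  For q = 2 and q = 3 the class estimates give L >= n.  For
    q = 5, ..., 23 they give L >= n when s is large, and q * L > 2 * n * s when s
    is small ([no_data_below_29]).  For q >= 29 the classes with n/2 < m <= n
    alone give q * L > 2 * n * s: the density dens q of integers without prime
    factor <= q satisfies q * dens q > 4 ([rough_gap_medium_q] and, for the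
    largest q, [rough_gap_large_q]).  In all cases a contradiction results as soon
    as l >= 127. *)

(** * The ring of dilations *)

Record pos := Pos { pval :> nat; pos_gt0 : (0 < pval)%N }.
HB.instance Definition _ := [isSub for pval].
HB.instance Definition _ := [Choice of pos by <:].

Definition pone : pos := @Pos 1 isT.
Lemma pmul_subproof (x y : pos) : (0 < x * y)%N.
Proof. by rewrite muln_gt0 !pos_gt0. Qed.
Definition pmul (x y : pos) : pos := Pos (pmul_subproof x y).

Lemma pmulA : associative pmul.
Proof. by move=> x y z; apply: val_inj; rewrite /= mulnA. Qed.
Lemma pmul1 : left_id pone pmul.
Proof. by move=> x; apply: val_inj; rewrite /= mul1n. Qed.
Lemma pmul_1 : right_id pone pmul.
Proof. by move=> x; apply: val_inj; rewrite /= muln1. Qed.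
Lemma pmul_unit (x y : pos) : pmul x y = pone -> x = pone /\ y = pone.
Proof.
move/(congr1 val)/eqP; rewrite /= muln_eq1 => /andP[/eqP x1 /eqP y1].
by split; apply: val_inj.
Qed.
Lemma pmulC : commutative pmul.
Proof. by move=> x y; apply: val_inj; rewrite /= mulnC. Qed.

HB.instance Definition _ :=
  Choice_isMonomialDef.Build pos pmulA pmul1 pmul_1 pmul_unit.
HB.instance Definition _ := MonomialDef_isConomialDef.Build pos pmulC.

(** All that is used of the monoid ring: elements are determined by their
    supports, addition is symmetric difference of supports, and monomials multiply
    like positive integers.  The ring is obtained from an opaque existence lemma
    so that unification can never unfold the convolution product. *)
Record dilation_ring := DilationRing {
  dcar :> comNzRingType;
  dmono : pos -> dcar;
  dsupp : dcar -> {fset pos};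
  dsupp_inj : forall A B, dsupp A =i dsupp B -> A = B;
  dsuppD : forall A B x,
    (x \in dsupp (A + B)) = (x \in dsupp A) (+) (x \in dsupp B);
  dsupp_mono : forall x, dsupp (dmono x) = [fset x];
  dmonoM : forall x y, dmono x * dmono y = dmono (pmul x y) }.

Lemma dilation_ring_exists : dilation_ring.
Proof.
have F2_cases (c : 'F_2) : c = 0 \/ c = 1.
  by case: c => [[|[|//]] i]; [left|right]; apply: val_inj.
have coefE (A : {malg 'F_2[pos]}) x : A@_x = (x \in msupp A)%:R.
  case: msuppP => // xA; case: (F2_cases A@_x) => // /eqP.
  by rewrite mcoeff_eq0 xA.
exists {malg 'F_2[pos]} (fun x => << x >>) msupp.
- by move=> A B AB; apply/malgP => x; rewrite !coefE AB.
- move=> A B x; rewrite -mcoeff_neq0 mcoeffD !coefE.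
  by case: (x \in msupp A); case: (x \in msupp B).
- by move=> x; apply: msuppU1.
- by move=> x y; rewrite malgM_def fgmulUU mul1r.
Qed.

Definition R : comNzRingType := dcar dilation_ring_exists.
Definition mono : pos -> R := @dmono dilation_ring_exists.
Definition supp : R -> {fset pos} := @dsupp dilation_ring_exists.

(** * Weights and restrictions *)

Section Weight.

Implicit Types (A B C g h : R) (x y z : pos) (Q : pred pos).

Definition wt A : nat := #|` supp A|.

Lemma mem_mono x y : (y \in supp (mono x)) = (y == x).
Proof. by rewrite [supp _]dsupp_mono inE. Qed.

Lemma monoM x y : mono x * mono y = mono (pmul x y).
Proof. exact: dmonoM. Qed.

Lemma memD A B x : (x \in supp (A + B)) = (x \in supp A) (+) (x \in supp B).
Proof. exact: dsuppD. Qed.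

Lemma supp_ext A B : supp A =i supp B -> A = B.
Proof. exact: dsupp_inj. Qed.

Lemma addRR A : A + A = 0.
Proof.
by apply: supp_ext => x; rewrite -[in RHS](addr0 0) !memD !addbb.
Qed.

Lemma oppRE A : - A = A.
Proof. by apply/eqP; rewrite eq_sym -addr_eq0 addRR. Qed.

Lemma addR_eq0 A B : A + B = 0 -> A = B.
Proof. by move/eqP; rewrite addr_eq0 oppRE => /eqP. Qed.

Lemma addRK A B : A + B + B = A.
Proof. by rewrite -addrA addRR addr0. Qed.

Lemma supp0 : supp 0 = fset0.
Proof. by apply/fsetP => x; rewrite -(addRR 0) memD addbb inE. Qed.

Lemma mem_sum (I : Type) (s : seq I) (P : pred I) (G : I -> R) x :
  (x \in supp (\sum_(i <- s | P i) G i)) =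
  odd (\sum_(i <- s | P i) (x \in supp (G i))).
Proof.
elim: s => [|i s IHs]; first by rewrite !big_nil supp0 inE.
by rewrite !big_cons; case: (P i); rewrite // memD IHs oddD oddb.
Qed.

Lemma mem_sum_mono (s : seq pos) Q x : uniq s ->
  (x \in supp (\sum_(y <- s | Q y) mono y)) = Q x && (x \in s).
Proof.
move=> us; rewrite mem_sum (eq_bigr (fun y => (y == x) : nat)); last first.
  by move=> y _; rewrite mem_mono eq_sym.
rewrite big_mkcond /= (eq_bigr (fun y => ((y == x) && Q x : nat))); last first.
  by move=> y _; case: eqP => [->|_]; case: (Q _).
case: (Q x) => /=; last by rewrite big1 // => y _; rewrite andbF.
have -> : (\sum_(y <- s) ((y == x) && true))%N = count (pred1 x) s.
  rewrite -sum1_count [RHS]big_mkcond; apply: eq_bigr => y _.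
  by rewrite andbT /=; case: (y == x).
by rewrite count_uniq_mem // oddb.
Qed.

Lemma supp_sumE A : A = \sum_(x <- supp A) mono x.
Proof. by apply: supp_ext => x; rewrite mem_sum_mono ?fset_uniq. Qed.

Lemma supp_eq0 A : (supp A == fset0) = (A == 0).
Proof.
apply/eqP/eqP => [A0|->]; last exact: supp0.
by apply: supp_ext => x; rewrite A0 supp0.
Qed.

Lemma wt_gt0 A : (0 < wt A)%N = (A != 0).
Proof. by rewrite lt0n cardfs_eq0 supp_eq0. Qed.

Lemma wt0 : wt 0 = 0%N.
Proof. by rewrite /wt supp0 cardfs0. Qed.

Lemma wt_mono x : wt (mono x) = 1%N.
Proof. by rewrite /wt [supp _]dsupp_mono cardfs1. Qed.

Lemma suppD_le A B : supp (A + B) `<=` supp A `|` supp B.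
Proof. by apply/fsubsetP => x; rewrite memD inE; case: (x \in supp A). Qed.

Lemma wtD A B : (wt (A + B) <= wt A + wt B)%N.
Proof.
apply: (leq_trans (fsubset_leq_card (suppD_le A B))).
by rewrite cardfsU leq_subr.
Qed.

Lemma wt_sum (I : eqType) (s : seq I) (P : pred I) (G : I -> R) :
  (wt (\sum_(i <- s | P i) G i)%R <= \sum_(i <- s | P i) wt (G i))%N.
Proof.
elim: s => [|i s IHs]; first by rewrite !big_nil wt0.
rewrite !big_cons; case: (P i) => //.
by apply: leq_trans (wtD _ _) _; rewrite leq_add2l.
Qed.

Lemma mono_ind (P : R -> Prop) :
  P 0 -> (forall A B, P A -> P B -> P (A + B)) -> (forall x, P (mono x)) ->
  forall A, P A.
Proof.
by move=> P0 PD PU A; rewrite [A]supp_sumE; elim/big_ind: _.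
Qed.

Lemma mem_monoM x A y : (pmul x y \in supp (mono x * A)) = (y \in supp A).
Proof.
elim/mono_ind: A => [|A B IA IB|z]; first by rewrite mulr0 supp0 !inE.
  by rewrite mulrDr [LHS]memD [RHS]memD IA IB.
by rewrite monoM !mem_mono -!val_eqE /= eqn_pmul2l ?pos_gt0.
Qed.

Lemma mem_monoM_inv x A z : z \in supp (mono x * A) ->
  exists2 y, y \in supp A & z = pmul x y.
Proof.
rewrite {1}[A]supp_sumE mulr_sumr mem_sum big_seq => zA.
have /hasP[y yA /eqP->] : has (fun y => z == pmul x y) (supp A).
  apply: contraLR zA => /hasPn zN; rewrite big1 // => y /zN zy.
  by rewrite monoM mem_mono (negPf zy).
by exists y.
Qed.

Lemma supp_monoM x A : supp (mono x * A) = [fset pmul x y | y in supp A].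
Proof.
apply/fsetP => z; apply/idP/imfsetP => [/mem_monoM_inv[y yA ->]|[y yA ->]].
  by exists y.
by rewrite mem_monoM.
Qed.

Lemma pmulI x : injective (pmul x).
Proof.
move=> y z /(congr1 val) /eqP; rewrite /= eqn_pmul2l ?pos_gt0 // => /eqP.
exact: val_inj.
Qed.

Lemma wt_monoM x A : wt (mono x * A) = wt A.
Proof.
by rewrite /wt supp_monoM card_imfset //; apply: pmulI.
Qed.

Lemma mono_neq0 x : mono x != 0.
Proof. by rewrite -wt_gt0 wt_mono. Qed.

Lemma wtM A B : (wt (A * B) <= wt A * wt B)%N.
Proof.
rewrite [A]supp_sumE mulr_suml; apply: leq_trans (wt_sum _ _ _) _.
rewrite -supp_sumE (eq_bigr (fun _ => wt B)); last by move=> x _; rewrite wt_monoM.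
by rewrite big_const_seq count_predT iter_addn_0 mulnC.
Qed.

Definition restr Q A : R := \sum_(x <- supp A | Q x) mono x.

Lemma mem_restr Q A x : (x \in supp (restr Q A)) = Q x && (x \in supp A).
Proof. exact: mem_sum_mono (fset_uniq _). Qed.

Lemma restr0 Q : restr Q 0 = 0.
Proof. by rewrite /restr supp0 big_nil. Qed.

Lemma restrD Q A B : restr Q (A + B) = restr Q A + restr Q B.
Proof.
by apply: supp_ext => x; rewrite memD !mem_restr memD; case: (Q x).
Qed.

Lemma restr_id Q A : {in supp A, forall x, Q x} -> restr Q A = A.
Proof.
by move=> QA; apply: supp_ext => x; rewrite mem_restr andb_idl // => /QA.
Qed.

Lemma restr_none Q A : {in supp A, forall x, ~~ Q x} -> restr Q A = 0.
Proof.
move=> QA; apply: supp_ext => x; rewrite mem_restr supp0 inE.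
by apply/negP => /andP[Qx /QA]; rewrite Qx.
Qed.

Lemma restrC Q A : A = restr Q A + restr (predC Q) A.
Proof.
by apply: supp_ext => x; rewrite memD !mem_restr /=; case: (Q x); rewrite ?addbF.
Qed.

Lemma wt_restrC Q A : wt A = (wt (restr Q A) + wt (restr (predC Q) A))%N.
Proof.
rewrite {1}[A](restrC Q) /wt.
have -> : supp (restr Q A + restr (predC Q) A)
    = supp (restr Q A) `|` supp (restr (predC Q) A).
  apply/fsetP => x; rewrite memD inE !mem_restr /=.
  by case: (Q x); rewrite ?addbF ?orbF.
rewrite cardfsU.
rewrite (_ : _ `&` _ = fset0) ?cardfs0 ?subn0 //; apply/fsetP => x.
by rewrite in_fsetI in_fset0 !mem_restr /=; case: (Q x); rewrite ?andbF.
Qed.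

Lemma wtD_ge A B : (wt A <= wt (A + B) + wt B)%N.
Proof. by rewrite -{1}(addRK A B) wtD. Qed.

Lemma mem_mul_inv A B z : z \in supp (A * B) ->
  exists x y, [/\ x \in supp A, y \in supp B & z = pmul x y].
Proof.
rewrite {1}[A]supp_sumE mulr_suml mem_sum big_seq => zA.
have /hasP[x xA] : has (fun x => z \in supp (mono x * B)) (supp A).
  apply: contraLR zA => /hasPn zN; rewrite big1 // => x /zN zx.
  by rewrite (negPf zx).
by case/mem_monoM_inv => y yB ->; exists x, y.
Qed.

(** A condition on products that depends on one factor only, the other factor
    being homogeneous for it, can be pulled inside the product.  This and the next
    lemma are how valuations and divisibility act as gradings below. *)
Lemma restrM Q Q' A B :
  (forall x y, x \in supp A -> y \in supp B -> Q (pmul x y) = Q' y) ->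
  restr Q (A * B) = A * restr Q' B.
Proof.
move=> QQ; rewrite {1}[A]supp_sumE [X in X * restr _ _]supp_sumE !mulr_suml !big_seq.
rewrite (big_morph _ (@restrD Q) (@restr0 Q)); apply: eq_bigr => x xA.
apply: supp_ext => z; rewrite mem_restr.
apply/andP/idP => [[Qz /mem_monoM_inv[y yB zE]]|/mem_monoM_inv[y]].
  by rewrite zE mem_monoM mem_restr yB -(QQ x y) // -zE Qz.
by rewrite mem_restr => /andP[Q'y yB] ->; rewrite QQ // mem_monoM.
Qed.

Lemma restrMM Q QA QB A B :
  (forall x y, x \in supp A -> y \in supp B -> Q (pmul x y) = QA x && QB y) ->
  restr Q (A * B) = restr QA A * restr QB B.
Proof.
move=> QQ; rewrite {1}[A](restrC QA) mulrDl restrD.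
rewrite (@restrM Q QB (restr QA A)); last first.
  by move=> x y; rewrite mem_restr => /andP[Qx xA] yB; rewrite QQ // Qx.
rewrite [X in _ + X]restr_none ?addr0 // => z /mem_mul_inv[x [y [xA yB ->]]].
by move: xA; rewrite mem_restr => /andP[/= Qx xA]; rewrite QQ // (negPf Qx).
Qed.

(** A product of terms that can be written in a single way cannot cancel modulo
    2.  Maximal, minimal and extreme-valuation terms are all of this kind. *)
Lemma mem_mul_extreme A B x y : x \in supp A -> y \in supp B ->
  (forall x' y', x' \in supp A -> y' \in supp B ->
    (x' * y' = x * y)%N -> (x' = x :> nat) /\ (y' = y :> nat)) ->
  pmul x y \in supp (A * B).
Proof.
move=> xA yB ext.
have r1 C z : z \in supp C -> restr (pred1 z) C = mono z.
  move=> zC; apply: supp_ext => u; rewrite mem_restr mem_mono /=.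
  by case: eqP => // ->.
suff : restr (pred1 (pmul x y)) (A * B) = mono x * mono y.
  rewrite monoM => /(congr1 (fun C => pmul x y \in supp C)) /=.
  by rewrite mem_mono mem_restr eqxx => /andP[].
rewrite -(r1 A x) // -(r1 B y) //; apply: restrMM => x' y' x'A y'B /=.
apply/eqP/andP => [/(congr1 val) /= /ext[] // xx yy|[/eqP-> /eqP->//]].
by split; apply/eqP/val_inj.
Qed.

Lemma ex_max (phi : pos -> nat) A : A != 0 ->
  exists2 x, x \in supp A & forall y, y \in supp A -> (phi y <= phi x)%N.
Proof.
rewrite -supp_eq0 => /fset0Pn[z zA].
have [s] : exists s, s = supp A :> seq pos by exists (supp A).
move=> sE; have : z \in s by rewrite sE.
have -> : (exists2 x, x \in supp A &
      forall y, y \in supp A -> (phi y <= phi x)%N) <->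
    (exists2 x, x \in s & forall y, y \in s -> (phi y <= phi x)%N).
  by rewrite sE.
elim: s {A zA sE} z => // a s IHs z _.
case: s IHs => [_|b s IHs]; first by exists a; rewrite ?mem_head // => y /[!inE] /eqP->.
have [x xs xM] := IHs b (mem_head _ _).
case: (leqP (phi x) (phi a)) => [xa|/ltnW ax].
  exists a; rewrite ?mem_head // => y; rewrite in_cons => /orP[/eqP->//|/xM yx].
  exact: leq_trans yx xa.
by exists x; rewrite ?(in_cons a) ?xs ?orbT // => y; rewrite in_cons => /orP[/eqP->//|/xM].
Qed.

Lemma ex_min (phi : pos -> nat) A : A != 0 ->
  exists2 x, x \in supp A & forall y, y \in supp A -> (phi x <= phi y)%N.
Proof.
move=> A0; have [z _ zM] := ex_max phi A0.
have [x xA xM] := ex_max (fun y => phi z - phi y)%N A0.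
exists x => // y yA; have := xM y yA; have := zM y yA; have := zM x xA; lia.
Qed.

Definition maxel A : nat := \max_(x <- supp A) x.

Lemma le_maxel A x : x \in supp A -> (x <= maxel A)%N.
Proof. by move=> xA; apply: (@leq_bigmax_seq _ _ _ pval). Qed.

Lemma maxelP A : A != 0 -> exists2 x, x \in supp A & maxel A = x.
Proof.
move=> A0; have [x xA xM] := ex_max pval A0.
exists x => //; apply/eqP; rewrite eqn_leq le_maxel // andbT.
by apply/bigmax_leqP_seq => y yA _; apply: xM.
Qed.

Lemma mem_mul_max A B : A != 0 -> B != 0 ->
  exists2 z, z \in supp (A * B) & z = (maxel A * maxel B)%N :> nat.
Proof.
move=> /maxelP[x xA xE] /maxelP[y yB yE]; exists (pmul x y); rewrite ?xE ?yE //.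
apply: mem_mul_extreme => // x' y' /le_maxel x'A /le_maxel y'B E.
have := pos_gt0 x'; have := pos_gt0 y'.
move: x'A y'B E; rewrite xE yE; nia.
Qed.

Lemma mul_neq0 A B : A != 0 -> B != 0 -> A * B != 0.
Proof.
move=> A0 B0; have [z zAB _] := mem_mul_max A0 B0.
by rewrite -supp_eq0; apply/fset0Pn; exists z.
Qed.

Lemma maxelM A B : A != 0 -> B != 0 -> maxel (A * B) = (maxel A * maxel B)%N.
Proof.
move=> A0 B0; have [z zAB zE] := mem_mul_max A0 B0.
apply/eqP; rewrite eqn_leq -{2}zE le_maxel // andbT.
apply/bigmax_leqP_seq => u /mem_mul_inv[x [y [xA yB ->]]] _ /=.
by rewrite leq_mul ?le_maxel.
Qed.

Lemma wt_ge2 A x y : x \in supp A -> y \in supp A -> x != y :> nat ->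
  (2 <= wt A)%N.
Proof.
move=> xA yA xy; rewrite /wt.
have xy2 : #|` [fset x; y]| = 2%N by rewrite cardfs2 -val_eqE /= xy.
rewrite -[X in (X <= _)%N]xy2.
by apply: fsubset_leq_card; apply/fsubsetP => z; rewrite !inE => /orP[]/eqP->.
Qed.

(** The products of the largest terms and of the smallest terms both survive. *)
Lemma wt_mul_ge2 A B x y : A != 0 -> x \in supp B -> y \in supp B ->
  x != y :> nat -> (2 <= wt (A * B))%N.
Proof.
move=> A0 xB yB xy.
have B0 : B != 0 by rewrite -supp_eq0; apply/fset0Pn; exists x.
have [z zAB zE] := mem_mul_max A0 B0.
have [a aA aM] := ex_min pval A0.
have [b bB bM] := ex_min pval B0.
have abAB : pmul a b \in supp (A * B).
  apply: mem_mul_extreme => // a' b' /aM /= aa /bM /= bb E.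
  have := pos_gt0 a; have := pos_gt0 b; nia.
apply: (wt_ge2 zAB abAB); rewrite zE /=.
have aX := le_maxel aA; have := bM x xB; have := bM y yB.
have := le_maxel xB; have := le_maxel yB => yM xM' by_ bx_.
have bM' : (b < maxel B)%N by move/eqP: xy; lia.
have := pos_gt0 a => a0.
suff : (a * b < maxel A * maxel B)%N by lia.
apply: (@leq_ltn_trans (maxel A * b)%N); first by rewrite leq_mul2r aX orbT.
by rewrite ltn_pmul2l //; lia.
Qed.

Lemma wt_restrE Q A : wt (restr Q A) = count Q (supp A).
Proof.
rewrite /wt -size_filter; apply/perm_size/uniq_perm.
- exact: fset_uniq.
- by rewrite filter_uniq ?fset_uniq.
by move=> x; rewrite mem_filter mem_restr.
Qed.

Lemma wt_classes (T : Type) (s : seq T) (Q : T -> pred pos) h :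
  (forall x, x \in supp h -> (count (Q^~ x) s <= 1)%N) ->
  (\sum_(i <- s) wt (restr (Q i) h) <= wt h)%N.
Proof.
move=> Q1; rewrite (eq_bigr (fun i => \sum_(x <- supp h) (Q i x : nat))%N); last first.
  move=> i _; rewrite wt_restrE -sum1_count big_mkcond.
  by apply: eq_bigr => x _; case: (Q i x).
rewrite exchange_big /= /wt -sum1_size big_seq [X in (_ <= X)%N]big_seq.
apply: leq_sum => x /Q1; rewrite -sum1_count big_mkcond.
by congr (_ <= _)%N; apply: eq_bigr => i _; case: (Q i x).
Qed.

End Weight.

(** * Derivations and minimal multiples *)

Section Derivations.

Implicit Types (A B C X g h : R) (x y z : pos) (Q : pred pos).

Definition to_pos (k : nat) : pos := insubd pone k.

Lemma to_posE (k : nat) : (0 < k)%N -> to_pos k = k :> nat.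
Proof. exact: (insubdK pone). Qed.

Lemma to_posK x : to_pos x = x.
Proof. exact: valKd. Qed.

Lemma to_pos_divn p x : (p %| x)%N -> (0 < p)%N -> to_pos (x %/ p) = (x %/ p)%N :> nat.
Proof. by move=> px p0; rewrite to_posE // divn_gt0 // dvdn_leq ?pos_gt0. Qed.

Definition segment (n : nat) : R := \sum_(k <- iota 1 n) mono (to_pos k).

Lemma segmentE n : segment n = \sum_(x <- map to_pos (iota 1 n)) mono x.
Proof. by rewrite big_map. Qed.

Lemma uniq_to_pos_iota n : uniq (map to_pos (iota 1 n)).
Proof.
rewrite map_inj_in_uniq ?iota_uniq // => j k; rewrite !mem_iota => jn kn.
by move/(congr1 pval); rewrite !to_posE //; lia.
Qed.

Lemma mem_segment n x : (x \in supp (segment n)) = (x <= n)%N.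
Proof.
rewrite segmentE mem_sum_mono ?uniq_to_pos_iota //=.
apply/mapP/idP => [[k] /[!mem_iota] kn ->|xn]; first by rewrite to_posE; lia.
by exists (x : nat); rewrite ?to_posK // mem_iota pos_gt0 /=; lia.
Qed.

Lemma wt_restr_segment n Q : wt (restr Q (segment n)) = count (fun k => Q (to_pos k)) (iota 1 n).
Proof.
rewrite wt_restrE -[RHS](count_map to_pos); apply/permP/uniq_perm.
- exact: fset_uniq.
- exact: uniq_to_pos_iota.
move=> x; rewrite mem_segment; apply/idP/mapP => [xn|[k] /[!mem_iota] kn ->].
  by exists (x : nat); rewrite ?to_posK // mem_iota pos_gt0 /=; lia.
by rewrite to_posE; lia.
Qed.

Lemma wt_segment n : wt (segment n) = n.
Proof.
by have := wt_restr_segment n predT; rewrite count_predT size_iota restr_id.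
Qed.

Lemma monoI x : injective (fun A => mono x * A).
Proof.
move=> A B /= E; apply: supp_ext => y; rewrite -(mem_monoM x A) -(mem_monoM x B).
by rewrite E.
Qed.

Definition divm (p : pos) A : R := \sum_(x <- supp A) mono (to_pos (x %/ p)).

Lemma divmK (p : pos) A : (forall x, x \in supp A -> (p %| x)%N) ->
  mono p * divm p A = A.
Proof.
move=> pA; rewrite [RHS]supp_sumE /divm mulr_sumr !big_seq.
apply: eq_bigr => x /pA px; rewrite monoM; congr mono; apply: val_inj.
by rewrite /= to_pos_divn ?pos_gt0 // mulnC divnK.
Qed.

Lemma maxel_divm (p : pos) A : prime p -> (forall x, x \in supp A -> (p %| x)%N) ->
  A != 0 -> (maxel (divm p A) < maxel A)%N.
Proof.
move=> pp pA A0; have D0 : divm p A != 0.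
  by apply: contraNneq A0 => D0; rewrite -(divmK pA) D0 mulr0.
have [x xD ->] := maxelP D0; have xA : pmul p x \in supp A.
  by rewrite -(divmK pA) mem_monoM.
apply: leq_trans (le_maxel xA) => /=; rewrite -[X in (X < _)%N]mul1n.
by rewrite ltn_pmul2r ?pos_gt0 // prime_gt1.
Qed.

(** Modulo 2, the derivation at p multiplies a monomial by its p-valuation, so it
    only sees the terms of odd valuation. *)
Definition oddv (p : nat) : pred pos := fun x => odd (logn p x).

Lemma oddv_dvd p x : oddv p x -> (p %| x)%N.
Proof.
rewrite /oddv; case: (posnP (logn p x)) => [->//|].
by move=> l0 _; move: l0; rewrite logn_gt0 mem_primes => /and3P[].
Qed.

Lemma oddvM p x y : prime p -> oddv p (pmul x y) = oddv p x (+) oddv p y.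
Proof. by move=> pp; rewrite /oddv lognM ?pos_gt0 // oddD. Qed.

(** The formal derivative in the variable p, the ring being a polynomial ring over
    the primes: p^e * m with p not dividing m goes to e * p^(e-1) * m. *)
Definition pderiv (p : pos) A : R := divm p (restr (oddv p) A).

Lemma pderivE (p : pos) A : mono p * pderiv p A = restr (oddv p) A.
Proof. by rewrite divmK // => x; rewrite mem_restr => /andP[/oddv_dvd]. Qed.

Lemma wt_pderiv (p : pos) A : wt (pderiv p A) = wt (restr (oddv p) A).
Proof. by rewrite -pderivE wt_monoM. Qed.

(** The Leibniz rule, read off from the grading by the parity of the valuation:
    in a product the odd part is odd times even plus even times odd, and the
    odd times odd contributions cancel modulo 2. *)
Lemma restr_oddM (p : nat) A B : prime p ->
  restr (oddv p) (A * B) = restr (oddv p) A * B + A * restr (oddv p) B.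
Proof.
move=> pp; pose Q := oddv p.
have QM x y : Q (pmul x y) = Q x (+) Q y by apply: oddvM.
have evM C : restr Q (restr (predC Q) A * C) = restr (predC Q) A * restr Q C.
  apply: restrM => x y; rewrite mem_restr => /andP[/= Qx _] _.
  by rewrite QM (negPf Qx).
have odM C : restr Q (restr Q A * C) = restr Q A * restr (predC Q) C.
  apply: restrM => x y; rewrite mem_restr => /andP[/= Qx _] _.
  by rewrite QM Qx.
rewrite -!/Q {1}[A](restrC Q) mulrDl restrD evM odM.
have -> : restr Q A * B = restr Q A * restr Q B + restr Q A * restr (predC Q) B.
  by rewrite -mulrDr -restrC.
have -> : A * restr Q B = restr Q A * restr Q B + restr (predC Q) A * restr Q B.
  by rewrite -mulrDl -restrC.
by rewrite addrACA addRR add0r.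
Qed.

Lemma pderivM (p : pos) A B : prime p ->
  pderiv p (A * B) = pderiv p A * B + A * pderiv p B.
Proof.
move=> pp; apply: (@monoI p); rewrite /= pderivE restr_oddM //.
by rewrite -!pderivE; ring.
Qed.

Lemma logn_big p x n : prime p -> (x <= n)%N -> (n < 2 * p)%N ->
  logn p x = (x == p :> nat).
Proof.
move=> pp xn np; case: eqP => [->|/eqP xp]; first by rewrite logn_prime ?eqxx.
apply/eqP; rewrite -leqn0 leqNgt logn_gt0 mem_primes pp pos_gt0 /=.
apply/negP => /dvdnP[[|[|m]] xE]; have := pos_gt0 x; move/eqP: xp; nia.
Qed.

Lemma pderiv_segment (p : pos) n : prime p -> (p <= n)%N -> (n < 2 * p)%N ->
  pderiv p (segment n) = 1.
Proof.
move=> pp pn np; apply: (@monoI p); rewrite /= pderivE mulr1.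
apply: supp_ext => x; rewrite mem_restr mem_segment mem_mono -val_eqE /=.
apply/andP/eqP => [[]|/val_inj->]; last by rewrite /oddv; split=> //; rewrite logn_prime ?eqxx.
by rewrite /oddv => + xn; rewrite (logn_big pp xn np); case: eqP.
Qed.

Lemma oddv_prime (p : pos) : prime p -> oddv p p.
Proof. by move=> pp; rewrite /oddv logn_prime ?eqxx. Qed.

Lemma pderiv_even (p : pos) A : prime p ->
  pderiv p (mono p * A) = restr (predC (oddv p)) A.
Proof.
move=> pp; apply: (@monoI p); rewrite /= pderivE; apply: restrM => x y.
by rewrite mem_mono => /eqP-> _; rewrite oddvM // oddv_prime.
Qed.

Lemma pderiv_deriv (p : pos) A : prime p -> pderiv p (pderiv p A) = 0.
Proof.
move=> pp; rewrite {1}/pderiv restr_none; first by rewrite /divm supp0 big_nil.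
move=> x xD; have : pmul p x \in supp (restr (oddv p) A).
  by rewrite -pderivE mem_monoM.
by rewrite mem_restr oddvM // oddv_prime // => /andP[].
Qed.

(** Here A is a nonzero multiplier with wt (f * A) minimal and, among those, with
    smallest largest term. *)
Section Minimal.

Variables (n : nat) (A : R).
Hypothesis n_gt0 : (0 < n)%N.
Hypothesis A0 : A != 0.
Hypothesis wt_min : forall B, B != 0 -> (wt (segment n * A) <= wt (segment n * B))%N.
Hypothesis maxel_min : forall B, B != 0 -> (wt (segment n * B) <= wt (segment n * A))%N ->
  (maxel A <= maxel B)%N.

Lemma segment_neq0 : segment n != 0.
Proof. by rewrite -wt_gt0 wt_segment. Qed.

(** Dividing A by a common prime factor keeps the weight of the multiple and
    decreases the largest term. *)
Lemma not_all_dvd (p : pos) : prime p ->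
  ~ (forall x, x \in supp A -> (p %| x)%N).
Proof.
move=> pp pA; have := maxel_divm pp pA A0; rewrite ltnNge => /negP; apply.
apply: maxel_min; last by rewrite -{2}(divmK pA) mulrCA wt_monoM.
by apply: contraNneq A0 => D0; rewrite -(divmK pA) D0 mulr0.
Qed.

Lemma not_all_dvd_mul (p : pos) : prime p ->
  ~ (forall x, x \in supp (segment n * A) -> (p %| x)%N).
Proof.
move=> pp ph; apply: (not_all_dvd pp) => x xA; apply/negPn/negP => px.
pose Q := fun x : pos => ~~ (p %| x)%N.
have E : restr Q (segment n * A) = restr Q (segment n) * restr Q A.
  by apply: restrMM => u v _ _; rewrite /Q /= Euclid_dvdM // negb_or.
have : restr Q (segment n) * restr Q A != 0.
  apply: mul_neq0; rewrite -supp_eq0; apply/fset0Pn.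
    by exists pone; rewrite mem_restr mem_segment n_gt0 /Q dvdn1 neq_ltn prime_gt1 ?orbT.
  by exists x; rewrite mem_restr xA /Q px.
by rewrite -E restr_none ?eqxx // => u uh; rewrite /Q negbK ph.
Qed.

Section TwoPrimes.

Variables p p' : pos.
Hypotheses (pp : prime p) (pp' : prime p') (pN : p != p' :> nat).
Hypotheses (pn : (p <= n)%N) (np : (n < 2 * p)%N).
Hypotheses (pn' : (p' <= n)%N) (np' : (n < 2 * p')%N).

Let D B := pderiv p B + pderiv p' B.

Lemma pderiv_segmentM (q : pos) B : prime q -> (q <= n)%N -> (n < 2 * q)%N ->
  pderiv q (segment n * B) = B + segment n * pderiv q B.
Proof. by move=> qq qn nq; rewrite pderivM // pderiv_segment // mul1r. Qed.

(** D f = 1 + 1 = 0. *)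
Lemma D_mul B : D (segment n * B) = segment n * D B.
Proof.
by rewrite /D !pderiv_segmentM // addrACA addRR add0r mulrDr.
Qed.

Lemma maxel_D B : D B != 0 -> (maxel (D B) < maxel B)%N.
Proof.
move=> D0; have [x xD ->] := maxelP D0.
have mxd (q : pos) : prime q -> x \in supp (pderiv q B) -> (x < maxel B)%N.
  move=> qq; rewrite -(mem_monoM q) pderivE mem_restr => /andP[_ /le_maxel].
  by have := prime_gt1 qq; have := pos_gt0 x; rewrite /=; nia.
move: xD; rewrite /D memD.
by case: (boolP (x \in supp (pderiv p B))) => [xp _|_ xp]; [apply: (mxd p)|apply: (mxd p')].
Qed.

Lemma ndvd_pp' : ~~ (p %| p')%N.
Proof. by rewrite dvdn_prime2. Qed.

Lemma ndvd_p'p : ~~ (p' %| p)%N.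
Proof. by rewrite dvdn_prime2 // eq_sym. Qed.

(** Let h = f * A and suppose D A <> 0.  Since D lowers the largest term, D h =
    f * D A cannot be as light as h, so the numbers of terms of h that are odd at
    p and odd at p' add up to more than wt h.  But D (p * p' * h) is again a
    multiple of f, and it picks the terms that are even at p or at p'; it is thus
    lighter than h and must vanish.  Comparing its two parts shows that p divides
    every term of h, hence every term of A, which is excluded. *)
Lemma pderiv_eq : pderiv p A = pderiv p' A.
Proof.
apply: addR_eq0; apply/eqP/negPn/negP => D0.
pose h := segment n * A.
have lt1 : (wt h < wt (restr (oddv p) h) + wt (restr (oddv p') h))%N.
  rewrite ltnNge; apply/negP => le1.
  (* otherwise D A would be a multiplier as light as A with smaller terms *)
  have := maxel_D D0; rewrite ltnNge => /negP; apply; apply: maxel_min => //.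
  rewrite -/(D A) -D_mul; apply: leq_trans le1.
  by rewrite -!wt_pderiv wtD.
(* multiplying by p * p' exchanges odd and even valuations *)
pose B := mono p * (mono p' * A).
have DhE : segment n * D B =
    mono p' * restr (predC (oddv p)) h + mono p * restr (predC (oddv p')) h.
  have -> : segment n * D B = D (mono p * (mono p' * h)).
    by rewrite -D_mul /B; congr D; rewrite /h; ring.
  rewrite /D pderiv_even // [mono p * (_ * _)]mulrCA pderiv_even //.
  congr (_ + _).
    apply: restrM => x y; rewrite mem_mono => /eqP-> _ /=; rewrite oddvM //.
    by rewrite [oddv p p'](introF idP) // => /oddv_dvd; apply/negP/ndvd_pp'.
  apply: restrM => x y; rewrite mem_mono => /eqP-> _ /=; rewrite oddvM //.
  by rewrite [oddv p' p](introF idP) // => /oddv_dvd; apply/negP/ndvd_p'p.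
have lt2 : (wt (segment n * D B) < wt h)%N.
  rewrite DhE; apply: leq_ltn_trans (wtD _ _) _; rewrite !wt_monoM.
  have := wt_restrC (oddv p) h; have := wt_restrC (oddv p') h; lia.
have DB0 : D B = 0.
  by apply/eqP/negPn/negP => /wt_min; rewrite leqNgt lt2.
move: DhE; rewrite DB0 mulr0 => /esym/addR_eq0 E.
apply: (not_all_dvd_mul pp) => x xh.
case: (boolP (oddv p x)) => [/oddv_dvd//|xe].
have : pmul p' x \in supp (mono p' * restr (predC (oddv p)) h).
  by rewrite mem_monoM mem_restr /= xe.
rewrite E => /mem_monoM_inv[y _ /(congr1 pval) /= pxy].
have : (p %| p' * x)%N by rewrite pxy dvdn_mulr.
by rewrite Euclid_dvdM // (negPf ndvd_pp').
Qed.

End TwoPrimes.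

End Minimal.

End Derivations.

(** * Square classes *)

Section Squares.
Local Open Scope nat_scope.

Definition is_square (x : nat) := has (fun y : nat => y * y == x) (iota 0 x.+1).
Definition sqroot (x : nat) := find (fun y : nat => y * y == x) (iota 0 x.+1).

Lemma sqrootP (x : nat) : is_square x -> sqroot x * sqroot x = x.
Proof.
move=> xs; have /eqP := nth_find 0 xs; rewrite nth_iota //.
by rewrite -[X in _ < X](size_iota 0) -has_find.
Qed.

Lemma is_square_sqr (y : nat) : is_square (y * y).
Proof. by apply/hasP; exists y => //; rewrite mem_iota add0n ltnS; nia. Qed.

Lemma is_squareP (x : nat) : reflect (exists y : nat, x = y * y) (is_square x).
Proof.
by apply: (iffP idP) => [/sqrootP <-|[y ->]]; [exists (sqroot x)|apply: is_square_sqr].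
Qed.

Lemma is_squareM_sqr (s x : nat) : 0 < s -> is_square (s * s * x) = is_square x.
Proof.
move=> s0; apply/is_squareP/is_squareP => [[y E]|[y ->]]; last first.
  by exists (s * y); rewrite mulnACA.
have /dvdnP[m yE] : s %| y.
  by rewrite -(@dvdn_pexp2r _ _ 2) // -!mulnn -E dvdn_mulr.
exists m; apply/eqP; rewrite -(@eqn_pmul2l (s * s)) ?muln_gt0 ?s0 // E yE.
by apply/eqP; ring.
Qed.

Lemma is_square_even (p x : nat) : 0 < x -> is_square x -> ~~ odd (logn p x).
Proof.
move=> + /is_squareP[y xE]; rewrite xE muln_gt0 andbb => y0.
by rewrite lognM // oddD addbb.
Qed.

(** Divide a and b by their gcd: the quotients are coprime and their product is a
    square, so a prime dividing the first quotient would divide it twice. *)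
Lemma sqfree_class_le (a b : nat) : 0 < a -> 0 < b ->
  (forall r, prime r -> ~~ (r * r %| a)) -> is_square (a * b) -> a %| b.
Proof.
move=> a0 b0 sfa /is_squareP[w E].
have g0 : 0 < gcdn a b by rewrite gcdn_gt0 a0.
have [a' aE] := dvdnP (dvdn_gcdl a b); have [b' bE] := dvdnP (dvdn_gcdr a b).
have cab : coprime a' b'.
  rewrite /coprime -(@eqn_pmul2r (gcdn a b)) // mul1n muln_gcdl.
  by rewrite -aE -bE.
suff a1 : a' = 1 by rewrite [X in X %| _]aE a1 mul1n dvdn_gcdr.
apply/eqP; rewrite eqn_leq; apply/andP; split; last first.
  by case: (a') aE a0 => // ->.
rewrite leqNgt; apply/negP => /pdivP[r rp ra].
have /is_squareP[v vE] : is_square (a' * b').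
  rewrite -(@is_squareM_sqr (gcdn a b)) //; apply/is_squareP; exists w.
  have -> : w * w = (a' * gcdn a b) * (b' * gcdn a b) by rewrite -aE -bE E.
  by ring.
have rv : r %| v.
  by rewrite -[_ %| v]orbb -Euclid_dvdM // -vE dvdn_mulr.
have : r * r %| a' * b' by rewrite vE dvdn_mul.
rewrite Gauss_dvdl; first by move=> rra; move/negP: (sfa r rp); apply; rewrite aE dvdn_mulr.
have : coprime r b' by apply: coprime_dvdl cab.
by rewrite coprimeMl => ->.
Qed.

(** The largest v with v^2 dividing j.  It identifies j inside a given class of
    positive integers modulo squares, which is what bounds the size of such a
    class. *)
Definition sqpart (j : nat) := \max_(v < j.+1 | v * v %| j) v.

Lemma sqpart_dvd (j : nat) : 0 < j -> sqpart j * sqpart j %| j.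
Proof.
move=> j0; rewrite /sqpart.
have i1 : (fun v : 'I_j.+1 => v * v %| j) (inord 1) by rewrite inordK ?dvd1n // ltnS.
have c0 : 0 < #|[pred v : 'I_j.+1 | v * v %| j]|.
  by apply/card_gt0P; exists (inord 1).
by have [v vP ->] := eq_bigmax_cond (fun v : 'I_j.+1 => v : nat) c0.
Qed.

Lemma sqpart_max (j v : nat) : 0 < j -> v * v %| j -> v <= sqpart j.
Proof.
move=> j0 vj; have vj1 : v < j.+1 by have := dvdn_leq j0 vj; nia.
exact: (@leq_bigmax_cond _ (fun v : 'I_j.+1 => v * v %| j) (fun v => v : nat) (Ordinal vj1)).
Qed.

Lemma sqpart_gt0 (j : nat) : 0 < j -> 0 < sqpart j.
Proof. by move=> j0; apply: sqpart_max => //; rewrite dvd1n. Qed.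

Lemma sqpart_inj (c j k : nat) : 0 < c -> 0 < j -> 0 < k ->
  is_square (c * j) -> is_square (c * k) -> sqpart j = sqpart k -> j = k.
Proof.
have sf (i e : nat) : 0 < i -> i = e * (sqpart i * sqpart i) ->
    forall r, prime r -> ~~ (r * r %| e).
  move=> i0 iE r rp; apply/negP => re.
  have : r * sqpart i <= sqpart i.
    (* a square factor r * r of the cofactor would enlarge the square part *)
    by apply: sqpart_max => //; rewrite [X in _ %| X]iE mulnACA dvdn_mul.
  by rewrite -[X in _ <= X]mul1n leq_pmul2r ?sqpart_gt0 // leqNgt prime_gt1.
move=> c0 j0 k0 /is_squareP[b jb] /is_squareP[d kd] E.
have [e jE] := dvdnP (sqpart_dvd j0); have [e' kE] := dvdnP (sqpart_dvd k0).
have e0 : 0 < e by case: (e) jE j0 => // ->.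
have e'0 : 0 < e' by case: (e') kE k0 => // ->.
have ee : is_square (e * e').
  rewrite -(@is_squareM_sqr (sqpart j * sqpart j)) ?muln_gt0 ?sqpart_gt0 //.
  rewrite -(@is_squareM_sqr c) //; apply/is_squareP; exists (b * d).
  rewrite [RHS]mulnACA -jb -kd.
  have -> : c * j * (c * k) =
      c * (e * (sqpart j * sqpart j)) * (c * (e' * (sqpart k * sqpart k))).
    by rewrite -jE -kE.
  by rewrite -E; ring.
have e'e : is_square (e' * e) by rewrite mulnC.
suff ee' : e = e' by rewrite jE kE ee' E.
apply/eqP; rewrite eqn_dvd !sqfree_class_le //; [exact: sf kE|exact: sf jE].
Qed.

(** The map sending j to its largest square divisor v^2 is injective on a square
    class, and v <= sqrt n. *)
Lemma count_sqclass (c n r : nat) : 0 < c -> n < r.+1 * r.+1 ->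
  count (fun j => is_square (c * j)) (iota 1 n) <= r.
Proof.
move=> c0 nr; rewrite -size_filter.
set s := [seq _ <- _ | _].
rewrite -(size_map sqpart s) -[X in _ <= X](size_iota 1 r); apply: uniq_leq_size.
  rewrite map_inj_in_uniq ?filter_uniq ?iota_uniq // => j k.
  rewrite !mem_filter !mem_iota => /andP[js /andP[j0 _]] /andP[ks /andP[k0 _]].
  exact: sqpart_inj js ks.
move=> v /mapP[j]; rewrite mem_filter !mem_iota => /and3P[_ j0 jn] ->.
rewrite sqpart_gt0 //=; have := dvdn_leq j0 (sqpart_dvd j0); nia.
Qed.

End Squares.

(** * A minimal multiplier has few terms *)

Section ShortMultiplier.

Implicit Types (A B C X g h : R) (x y z : pos) (Q : pred pos).

(** Squaring is additive in characteristic 2. *)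
Lemma sqr_sum (s : seq pos) :
  (\sum_(x <- s) mono x) * (\sum_(x <- s) mono x) = \sum_(x <- s) mono (pmul x x).
Proof.
elim: s => [|a s IHs]; first by rewrite !big_nil mulr0.
rewrite !big_cons -IHs -monoM; set S := \sum_(x <- s) _.
have -> : (mono a + S) * (mono a + S) =
    mono a * mono a + S * S + (mono a * S + mono a * S) by ring.
by rewrite addRR addr0.
Qed.

Lemma wt_sum_mono (s : seq pos) : uniq s -> wt (\sum_(x <- s) mono x) = size s.
Proof.
move=> us; rewrite /wt; apply/perm_size/uniq_perm => //.
by move=> x; rewrite mem_sum_mono.
Qed.

Lemma sqr_supp A x : x \in supp (A * A) -> is_square x.
Proof.
rewrite [A]supp_sumE sqr_sum mem_sum => xA.
have /hasP[y _ /eqP->] : has (fun y => x == pmul y y) (supp A).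
  apply: contraLR xA => /hasPn xN; rewrite big_seq big1 // => y /xN xy.
  by rewrite mem_mono (negPf xy).
exact: is_square_sqr.
Qed.

Lemma wt_sqr A : wt (A * A) = wt A.
Proof.
rewrite {1 2}[A]supp_sumE sqr_sum -(big_map (fun x => pmul x x) xpredT mono).
rewrite wt_sum_mono ?size_map // map_inj_uniq ?fset_uniq // => x y.
by move/(congr1 pval) => /= E; apply: val_inj; apply/eqP; move: E => /=; nia.
Qed.

Lemma sqrt_exists B : (forall x, x \in supp B -> is_square x) -> exists k, B = k * k.
Proof.
move=> Bs; exists (\sum_(x <- supp B) mono (to_pos (sqroot x))).
rewrite -(big_map (fun x : pos => to_pos (sqroot x)) xpredT mono) sqr_sum big_map.
rewrite {1}[B]supp_sumE !big_seq; apply: eq_bigr => x /Bs xs.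
congr mono; apply: val_inj => /=; have := sqrootP xs; have := pos_gt0 x.
by case: (posnP (sqroot x)) => [->|r0 _]; [lia|rewrite to_posE].
Qed.

(** Each term y of B contributes the multiples of x * y in a segment that are
    squares, that is, one square class. *)
Lemma wt_square_part_le n r x B : (n < r.+1 * r.+1)%N ->
  (wt (restr (is_square \o pval) (mono x * (segment n * B)))%R <= wt B * r)%N.
Proof.
move=> nr; rewrite {1}[B]supp_sumE !mulr_sumr.
rewrite (big_morph _ (@restrD _) (@restr0 _)).
apply: leq_trans (wt_sum _ _ _) _.
rewrite -[wt B]sum1_size big_distrl /=; apply: leq_sum => y _.
rewrite mul1n; have -> : mono x * (segment n * mono y) = mono (pmul x y) * segment n.
  by rewrite -monoM; ring.
rewrite (@restrM _ (fun z => is_square (pmul x y * z))); last first.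
  by move=> u v; rewrite mem_mono => /eqP->.
rewrite wt_monoM wt_restr_segment.
apply: leq_trans (count_sqclass (pos_gt0 (pmul x y)) nr).
rewrite -!size_filter; apply: eq_leq; congr size; apply: eq_in_filter => k.
by rewrite mem_iota => k0; rewrite to_posE //; lia.
Qed.

Lemma count_le1 (T : eqType) (a : pred T) (s : seq T) : uniq s ->
  (forall u v, u \in s -> v \in s -> a u -> a v -> u = v) -> (count a s <= 1)%N.
Proof.
move=> us a1; rewrite -size_filter.
have : uniq [seq x <- s | a x] by rewrite filter_uniq.
have : forall u v, u \in [seq x <- s | a x] -> v \in [seq x <- s | a x] -> u = v.
  by move=> u v; rewrite !mem_filter => /andP[au us'] /andP[av vs]; apply: a1.
case: [seq _ <- _ | _] => [|u [|v t]] //= uv /andP[].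
by rewrite inE (uv u v) ?eqxx // !inE eqxx ?orbT.
Qed.

Lemma pderiv0_even (p : pos) B x : pderiv p B = 0 -> x \in supp B -> ~~ oddv p x.
Proof.
move=> d0 xB; apply/negP => xo.
by have := pderivE p B; rewrite d0 mulr0 => /(congr1 (fun C => x \in supp C)) /=;
  rewrite supp0 mem_restr xo xB inE.
Qed.

(** P is a list of more than r primes in (n/2, n], where r is the integer part of
    the square root of n (or larger). *)
Section Few.

Variables (n : nat) (A : R) (P : seq pos) (r : nat).
Hypothesis n_gt1 : (1 < n)%N.
Hypothesis A0 : A != 0.
Hypothesis wt_min : forall B, B != 0 -> (wt (segment n * A) <= wt (segment n * B))%N.
Hypothesis maxel_min : forall B, B != 0 -> (wt (segment n * B) <= wt (segment n * A))%N ->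
  (maxel A <= maxel B)%N.
Hypothesis uP : uniq P.
Hypothesis PP : forall p, p \in P -> [/\ prime p, (p <= n)%N & (n < 2 * p)%N].
Hypothesis nr : (n < r.+1 * r.+1)%N.
Hypothesis rP : (r < size P)%N.

Let h := segment n * A.

Lemma exists_p0 : exists p0, p0 \in P.
Proof. by case: P rP => // p0 s _; exists p0; rewrite mem_head. Qed.

Lemma derivative_structure : exists H K, [/\ A = H + segment n * K,
  forall p, p \in P -> pderiv p A = K & forall p, p \in P -> pderiv p h = H].
Proof.
have [p0 p0P] := exists_p0; have [pp0 pn0 np0] := PP p0P.
have E p : p \in P -> pderiv p A = pderiv p0 A.
  move=> pP; have [pp pn np] := PP pP.
  case: (eqVneq (p : nat) p0) => [/val_inj->//|pN].
  exact: (pderiv_eq (ltnW n_gt1) A0 wt_min maxel_min).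
exists (pderiv p0 h), (pderiv p0 A); split => //; last first.
  move=> p pP; have [pp pn np] := PP pP.
  by rewrite /h !pderiv_segmentM // E.
by rewrite /h pderiv_segmentM // addRK.
Qed.

(** For each p in P the terms of k0 * h that are odd at p form a shifted copy of
    H.  These |P| sets are disjoint because H is even at every prime of P, and
    they avoid the terms selected by Q. *)
Lemma odd_classes H (k0 : pos) Q :
  (forall p, p \in P -> pderiv p h = H) ->
  (forall p, p \in P -> ~~ oddv p k0) ->
  (forall p x, p \in P -> oddv p x -> ~~ Q x) ->
  (wt (restr Q (mono k0 * h)) + size P * wt H <= wt h)%N.
Proof.
move=> dH k0e QP; set g := mono k0 * h.
have dg p : p \in P -> pderiv p g = mono k0 * H.
  move=> pP; have [pp _ _] := PP pP; rewrite -(dH p pP).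
  apply: (@monoI p); rewrite /= mulrCA !pderivE; apply: restrM => x y.
  by rewrite mem_mono => /eqP-> _; rewrite oddvM // (negPf (k0e p pP)).
have Heven p x : p \in P -> x \in supp H -> ~~ oddv p x.
  move=> pP; apply: pderiv0_even; rewrite -(dH p pP) pderiv_deriv //.
  by case: (PP pP).
rewrite -(wt_monoM k0 h) -/g (wt_restrC Q g) leq_add2l.
have -> : (size P * wt H = \sum_(p <- P) wt (restr (oddv p) (restr (predC Q) g)))%N.
  rewrite -sum1_size big_distrl /= !big_seq; apply: eq_bigr => p pP.
  rewrite mul1n.
  have -> : restr (oddv p) (restr (predC Q) g) = restr (oddv p) g.
    apply: supp_ext => x; rewrite !mem_restr /=.
    by case: (boolP (oddv p x)) => [/(QP p x pP)->|].
  by rewrite -wt_pderiv dg // wt_monoM.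
apply: (@wt_classes pos P (fun p : pos => oddv p)) => x.
rewrite mem_restr => /andP[_ xg].
apply: (count_le1 uP) => p p' pP p'P px p'x.
have [pp _ _] := PP pP; have [pp' _ _] := PP p'P.
have : x \in supp (mono p * (mono k0 * H)).
  by rewrite -(dg p pP) pderivE mem_restr px.
case/mem_monoM_inv => z /mem_monoM_inv[y yH zE] xE.
apply/eqP/negPn/negP => pN; move: p'x.
rewrite xE zE !oddvM // (negPf (k0e p' p'P)) (negPf (Heven p' y p'P yH)) !addbF.
by move/oddv_dvd; rewrite dvdn_prime2 // => /eqP/val_inj E; rewrite E eqxx in pN.
Qed.

(** If K = 0, the disjoint copies of A = H inside h give the bound.  If K <> 0,
    take a term k0 of K, so that k0 * K has a nonzero part k^2 made of squares.  The
    square part of k0 * h is then (f * k)^2 up to at most wt H * r terms, and as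
    wt (f * k) >= wt h it leaves fewer than |P| * wt H other terms unless H = 0.
    With H = 0 the multiplier k is at least as light as A = f * K, while its
    largest term is at most that of K, which is n times smaller than that of A. *)
Theorem few_terms : (size P * wt A <= wt h)%N.
Proof.
have [H [K [AE dA dH]]] := derivative_structure.
case: (eqVneq K 0) => [K0|K0].
  have AH : A = H by rewrite AE K0 mulr0 addr0.
  rewrite AH -AH; have := @odd_classes H pone pred0 dH _ _; rewrite restr_none //.
  rewrite wt0 add0n -AH; apply => // p pP.
  by rewrite /oddv logn1.
have [k0 k0K] : exists k0, k0 \in supp K.
  by apply/fset0Pn; rewrite supp_eq0.
pose Q := is_square \o pval.
have k0e p : p \in P -> ~~ oddv p k0.
  move=> pP; apply: (pderiv0_even _ k0K); rewrite -(dA p pP) pderiv_deriv //.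
  by case: (PP pP).
have QP p x : p \in P -> oddv p x -> ~~ Q x.
  by move=> pP; apply: contraTN => /is_square_even; apply; exact: pos_gt0.
have := odd_classes dH k0e QP; set g := mono k0 * h => le1.
have gE : g = mono k0 * (segment n * H) + segment n * segment n * (mono k0 * K).
  by rewrite /g /h AE; ring.
have [k kE] : exists k, restr Q (mono k0 * K) = k * k.
  by apply: sqrt_exists => x; rewrite mem_restr => /andP[].
have k_neq0 : k != 0.
  apply: contraTneq k0K => k0'; have : pmul k0 k0 \notin supp (restr Q (mono k0 * K)).
    by rewrite kE k0' mulr0 supp0 inE.
  by rewrite mem_restr mem_monoM /Q /= is_square_sqr.
have QgE : restr Q g = restr Q (mono k0 * (segment n * H)) + (segment n * k) * (segment n * k).
  rewrite gE restrD; congr (_ + _).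
  rewrite (_ : segment n * k * (segment n * k) = segment n * segment n * (k * k)); last by ring.
  rewrite -kE; apply: restrM => x y /sqr_supp/sqrootP xE _; rewrite /Q /= -xE.
  by apply: is_squareM_sqr; have := pos_gt0 x; rewrite -xE; case: (sqroot x).
have le2 : (wt (segment n * k) <= wt (restr Q g) + wt H * r)%N.
  rewrite -wt_sqr; apply: leq_trans (leq_add (leqnn _) (wt_square_part_le k0 H nr)).
  by rewrite QgE addrC; apply: wtD_ge.
have le3 := wt_min k_neq0; rewrite -/h in le3.
have H0 : wt H = 0%N by nia.
have := maxel_min k_neq0; rewrite -/h => maxk.
have {maxk} : (maxel A <= maxel k)%N.
  by apply: maxk; move: le1 le2; rewrite H0 !mul0n !addn0 !muln0 !addn0; lia.
have -> : maxel A = (n * maxel K)%N.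
  rewrite AE; have -> : H = 0 by apply/eqP; rewrite -[_ == _]negbK -wt_gt0 H0.
  rewrite add0r maxelM //; last by rewrite -wt_gt0 wt_segment ltnW.
  congr (_ * _)%N; have [x xF maxE] := maxelP (segment_neq0 (ltnW n_gt1)).
  apply/eqP; rewrite eqn_leq {1}maxE -mem_segment xF /=.
  by rewrite -[X in (X <= _)%N](@to_posE n (ltnW n_gt1)) le_maxel // mem_segment to_posE // ltnW.
(* the terms of k^2 are terms of k0 * K, and k0 is a term of K *)
have mk : (maxel k * maxel k <= maxel K * maxel K)%N.
  rewrite -maxelM // -kE; apply: (@leq_trans (maxel (mono k0 * K))).
    apply/bigmax_leqP_seq => x; rewrite mem_restr => /andP[_ xK] _.
    exact: le_maxel.
  have [x /mem_monoM_inv[y yK xE] ->] := maxelP (mul_neq0 (mono_neq0 k0) K0).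
  by rewrite xE leq_mul ?le_maxel.
have [x _ maxK] := maxelP K0.
have := pos_gt0 x; rewrite -maxK => mK0 nk.
have {}mk : (maxel k <= maxel K)%N by rewrite leqNgt; apply/negP; nia.
nia.
Qed.

End Few.

End ShortMultiplier.

(** * Splitting by divisibility at a prime *)

Section Splitting.

Implicit Types (A B C X g h : R) (x y z : pos) (Q : pred pos).

Lemma count_dvdn (d n : nat) : count (dvdn d) (iota 1 n) = (n %/ d)%N.
Proof.
rewrite divn_count_dvd -sum1_count big_mkcond /= /index_iota subn1.
by apply: eq_bigr => k _; case: (d %| k)%N.
Qed.

Lemma sub_count_in (T : eqType) (a b : pred T) (s : seq T) :
  {in s, forall u, a u -> b u} -> (count a s <= count b s)%N.
Proof.
move=> ab; rewrite (@eq_in_count _ a (predI a b)); last first.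
  by move=> u us /=; case: (boolP (a u)) => // /(ab u us) ->.
by apply: sub_count => u /andP[].
Qed.

Definition pfree (p : nat) : pred pos := fun x => ~~ (p %| x)%N.

Lemma wt_restr_dvd_segment (p n : nat) : wt (restr (predC (pfree p)) (segment n)) = (n %/ p)%N.
Proof.
rewrite wt_restr_segment -count_dvdn; apply: eq_in_count => k; rewrite mem_iota => k0.
by rewrite /= /pfree negbK to_posE //; lia.
Qed.

Lemma restr_neq0 Q A x : x \in supp A -> Q x -> restr Q A != 0.
Proof.
by move=> xA Qx; rewrite -supp_eq0; apply/fset0Pn; exists x; rewrite mem_restr Qx.
Qed.

Lemma pfreeM (p : nat) x y : prime p -> pfree p (pmul x y) = pfree p x && pfree p y.
Proof. by move=> pp; rewrite /pfree Euclid_dvdM // negb_or. Qed.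

(** Multiplication by terms prime to p preserves divisibility by p, so the two
    parts of A cannot cancel against each other. *)
Lemma wt_mul_pfree (p : nat) A B : prime p ->
  (forall x, x \in supp B -> pfree p x) ->
  wt (A * B) = (wt (restr (pfree p) A * B) + wt (restr (predC (pfree p)) A * B))%N.
Proof.
move=> pp fB; rewrite (wt_restrC (pfree p)) ![_ * B]mulrC.
by congr (wt _ + wt _)%N; apply: restrM => x y xB yA; rewrite /= pfreeM // fB.
Qed.

(** Up to n/p terms, f is prime to p, and multiplication by the part f0 of f that
    is prime to p keeps the two halves of A apart.  So wt (f0 * A) is the sum of
    the contributions of the halves, and each of them is at least c up to the
    error made in replacing f by f0. *)
Lemma two_halves (n p : nat) A c : prime p -> 
  restr (pfree p) A != 0 -> restr (predC (pfree p)) A != 0 ->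
  (forall B, B != 0 -> (c <= wt (segment n * B))%N) ->
  (2 * c <= wt (segment n * A)%R + 2 * (n %/ p) * wt A)%N.
Proof.
move=> pp + + cmin; set Q := pfree p => A1 A2.
pose f0 := restr Q (segment n); pose f1 := restr (predC Q) (segment n).
have FE : segment n = f0 + f1 := restrC _ _.
have wf1 : wt f1 = (n %/ p)%N := wt_restr_dvd_segment p n.
have bnd B : (wt (segment n * B) <= wt (B * f0) + (n %/ p) * wt B)%N.
  by rewrite FE mulrDl [f0 * B]mulrC; apply: leq_trans (wtD _ _) _; rewrite leq_add2l -wf1 wtM.
have le1 := leq_trans (cmin _ A1) (bnd _).
have le2 := leq_trans (cmin _ A2) (bnd _).
have sp : wt (A * f0) = (wt (restr Q A * f0) + wt (restr (predC Q) A * f0))%N.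
  by apply: wt_mul_pfree => // x; rewrite mem_restr => /andP[].
have le3 : (wt (A * f0) <= wt (segment n * A) + (n %/ p) * wt A)%N.
  apply: (@leq_trans (wt (segment n * A) + wt (f1 * A))%N).
    by rewrite FE mulrDl [f0 * A]mulrC; apply: wtD_ge.
  by rewrite leq_add2l -wf1 wtM.
move: le1 le2 le3; rewrite sp -mulnA (wt_restrC Q A) !mulnDr; lia.
Qed.

Lemma wt1_mono A : wt A = 1%N -> exists x, A = mono x.
Proof.
move/eqP/cardfs1P => [x xE]; exists x; apply: supp_ext => y.
by rewrite xE inE mem_mono.
Qed.

(** Common terms of x * f and y * f come from multiples k of
    y / gcd(x, y) >= 2, so there are at most n/2 of them. *)
Lemma wt_pair (n : nat) x y : (x < y)%N -> (n <= wt (segment n * (mono x + mono y)))%N.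
Proof.
move=> xy; rewrite mulrDr ![segment n * _]mulrC.
set X := mono x * segment n; set Y := mono y * segment n.
pose Q := fun z => z \in supp Y.
have wX : wt X = n by rewrite wt_monoM wt_segment.
have wY : wt Y = n by rewrite wt_monoM wt_segment.
have cX : (wt (restr Q X) <= n %/ 2)%N.
  rewrite (@restrM _ (fun z => Q (pmul x z))); last first.
    by move=> u v; rewrite mem_mono => /eqP->.
  rewrite wt_monoM wt_restr_segment.
  (* x * k is divisible by y exactly when k is divisible by d *)
  pose d := (y %/ gcdn x y)%N.
  have d2 : (1 < d)%N.
    rewrite /d ltn_divRL ?dvdn_gcdr // mul1n.
    by apply: leq_ltn_trans xy; rewrite dvdn_leq ?pos_gt0 ?dvdn_gcdl.
  apply: (@leq_trans (n %/ d)%N); last first.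
    by rewrite leq_divRL //; have := leq_divM n d; nia.
  rewrite -count_dvdn; apply: sub_count_in => k; rewrite mem_iota => k0.
  have kE : to_pos k = k :> nat by rewrite to_posE //; lia.
  rewrite /Q => /mem_monoM_inv[z _ /(congr1 pval)] /=; rewrite kE => E.
  have : (y %| x * k)%N by rewrite E dvdn_mulr.
  have g0 : (0 < gcdn x y)%N by rewrite gcdn_gt0 pos_gt0.
  have [x' xE] := dvdnP (dvdn_gcdl x y).
  have yE : (y = d * gcdn x y :> nat)%N by rewrite divnK ?dvdn_gcdr.
  have cd : coprime d x'.
    rewrite /coprime -(@eqn_pmul2r (gcdn x y)) // mul1n muln_gcdl.
    by rewrite -yE -xE gcdnC.
  rewrite [X in (X %| _)%N]yE [X in (_ %| X * _)%N]xE mulnAC.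
  by rewrite dvdn_pmul2r // Gauss_dvdr.
rewrite (wt_restrC Q) !restrD [restr Q Y]restr_id; last by [].
rewrite [restr (predC Q) Y]restr_none ?addr0; last by move=> z; rewrite /= negbK.
have := wtD_ge Y (restr Q X); rewrite [Y + _]addrC wY.
have := wt_restrC Q X; rewrite wX.
move: cX {wX wY}; move: (wt (restr Q X)) (wt (restr (predC Q) X)) (wt (_ + Y)).
by move=> a b c; lia.
Qed.

Lemma wt2_pair A : wt A = 2%N -> exists x y, (x < y)%N /\ A = mono x + mono y.
Proof.
move=> A2; have A0 : A != 0 by rewrite -wt_gt0 A2.
have [x xA xE] := maxelP A0.
have r1 : restr (pred1 x) A = mono x.
  by apply: supp_ext => u; rewrite mem_restr mem_mono /=; case: eqP => // ->.
have /wt1_mono[z zE] : wt (restr (predC (pred1 x)) A) = 1%N.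
  by have := wt_restrC (pred1 x) A; rewrite r1 wt_mono A2 add1n => -[].
exists z, x; split; last by rewrite {1}[A](restrC (pred1 x)) r1 zE addrC.
have : z \in supp (restr (predC (pred1 x)) A) by rewrite zE mem_mono.
rewrite mem_restr /= => /andP[zx /le_maxel]; rewrite xE leq_eqVlt.
by case/orP => // /eqP/val_inj zxE; rewrite zxE eqxx in zx.
Qed.

(** Grade by the p-valuation.  The lowest level of X * B is the lowest level X'
    of X times the part of B prime to p.  The highest level of X * B is nonzero and
    lies strictly above, because B has a term divisible by p; it supplies one more
    term. *)
Lemma wt_extreme_levels (p : nat) X B x y : prime p -> X != 0 ->
  x \in supp B -> pfree p x -> y \in supp B -> ~~ pfree p y ->
  exists2 X', X' != 0 & (1 + wt (X' * restr (pfree p) B) <= wt (X * B))%N.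
Proof.
have low (i j k : nat) : (k <= i)%N -> (i + j == k)%N = (i == k) && (j == 0%N).
  by lia.
have high (i j k l : nat) : (i <= k)%N -> (j <= l)%N ->
  (i + j == k + l)%N = (i == k) && (j == l) by lia.
have above (i j k l : nat) : (k <= i)%N -> (l <= j)%N -> l != 0%N ->
  (i + j != k)%N by lia.
move=> pp X0 xB xp yB yp; pose phi (z : pos) := logn p z.
have phiM u v : phi (pmul u v) = (phi u + phi v)%N by rewrite /phi lognM ?pos_gt0.
have phi0 z : (phi z == 0)%N = pfree p z.
  by rewrite /phi /pfree -leqn0 leqNgt logn_gt0 mem_primes pp pos_gt0.
have B0 : B != 0 by rewrite -supp_eq0; apply/fset0Pn; exists x.
have [a aX aM] := ex_min phi X0.
have [a' aX' aM'] := ex_max phi X0; have [b' bB' bM'] := ex_max phi B0.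
(* a is at the lowest level of X, and a' and b' are at the highest of X and B *)
exists (restr (fun z => phi z == phi a) X).
  by apply: (restr_neq0 aX).
pose Q z := phi z == phi a.
have E1 : restr Q (X * B) = restr Q X * restr (pfree p) B.
  apply: restrMM => u v uX vB; rewrite /Q phiM -phi0.
  exact: low (aM u uX).
rewrite -E1 (wt_restrC Q (X * B)) addnC leq_add2l wt_gt0.
pose Q' z := phi z == (phi a' + phi b')%N.
have E2 : restr Q' (X * B) =
    restr (fun z => phi z == phi a') X * restr (fun z => phi z == phi b') B.
  apply: restrMM => u v uX vB; rewrite /Q' phiM.
  exact: high (aM' u uX) (bM' v vB).
have : restr Q' (X * B) != 0.
  by rewrite E2; apply: mul_neq0; [apply: (restr_neq0 aX')|apply: (restr_neq0 bB')].
rewrite -supp_eq0 => /fset0Pn[z]; rewrite mem_restr => /andP[/eqP zE zXB].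
apply: (restr_neq0 zXB); rewrite /Q /= zE.
by apply: above (aM a' aX') (bM' y yB) _; rewrite phi0.
Qed.

End Splitting.

(** * Rough classes *)

Definition rough (q : nat) : pred nat :=
  fun m => all (fun p => ~~ (p %| m)%N) [seq p <- iota 0 q.+1 | prime p].

Lemma roughP (q m : nat) :
  reflect (forall p, prime p -> (p <= q)%N -> ~~ (p %| m)%N) (rough q m).
Proof.
apply: (iffP allP) => [mq p pp pq|mq p]; last first.
  by rewrite mem_filter mem_iota => /andP[pp /andP[_ pq]]; apply: mq.
by apply: mq; rewrite mem_filter pp mem_iota.
Qed.

(** The largest divisor of m without prime factor <= q. *)
Definition rpart (q m : nat) : nat := m`_[pred p | q < p]%N.

Lemma rpartM (q m k : nat) : (0 < m)%N -> (0 < k)%N ->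
  rpart q (m * k) = (rpart q m * rpart q k)%N.
Proof. exact: partnM. Qed.

Lemma rpart_dvd (q m : nat) : (rpart q m %| m)%N.
Proof. exact: dvdn_part. Qed.

Lemma rpart_rough (q m : nat) : (0 < m)%N -> rough q m -> rpart q m = m.
Proof.
move=> m0 /roughP mq; apply: part_pnat_id; apply/pnatP => // p pp pm.
by rewrite inE ltnNge; apply/negP => /(mq p pp); rewrite pm.
Qed.

Lemma rpart_smooth (q m : nat) : (0 < m)%N ->
  (forall p, prime p -> (p %| m)%N -> (p <= q)%N) -> rpart q m = 1%N.
Proof.
move=> m0 mq; apply: part_p'nat; apply/pnatP => // p pp pm.
by rewrite !inE -leqNgt; apply: mq.
Qed.

Section RoughClasses.

Implicit Types (A B C X g h : R) (x y z : pos) (Q : pred pos).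

Section OneClass.

Variables (n q m : nat).
Hypothesis qp : prime q.
Hypotheses (m_gt0 : (0 < m)%N) (m_rough : rough q m).

(** The terms k * m <= n of f with k having only prime factors <= q. *)
Definition rough_class : R := restr (fun x => rpart q x == m) (segment n).

Lemma mem_rough_class (k : nat) : (0 < k)%N -> (k * m <= n)%N ->
  (forall p, prime p -> (p %| k)%N -> (p <= q)%N) -> to_pos (k * m) \in supp rough_class.
Proof.
move=> k0 kn ks; have km0 : (0 < k * m)%N by rewrite muln_gt0 k0.
rewrite mem_restr mem_segment to_posE // kn andbT rpartM //.
by rewrite rpart_smooth // mul1n rpart_rough.
Qed.

Lemma mem_rough_class_prime (p : nat) : prime p -> (p <= q)%N -> (p * m <= n)%N ->
  to_pos (p * m) \in supp rough_class.
Proof.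
move=> pp pq pn; apply: mem_rough_class => //; first exact: prime_gt0.
by move=> r rp; rewrite dvdn_prime2 // => /eqP->.
Qed.

Lemma mem_rough_class1 : (m <= n)%N -> to_pos (1 * m) \in supp rough_class.
Proof.
move=> mn; apply: mem_rough_class; rewrite ?mul1n // => p pp.
by rewrite dvdn1 => /eqP p1; rewrite p1 in pp.
Qed.

Lemma rough_class_dvd x : x \in supp rough_class -> (m %| x)%N /\ (x <= n)%N.
Proof. by rewrite mem_restr mem_segment => /andP[/eqP<- ->]; rewrite rpart_dvd. Qed.

Lemma wt_class1 X : (m <= n)%N -> (n < 2 * m)%N -> wt (X * rough_class) = wt X.
Proof.
move=> mn nm; suff -> : rough_class = mono (to_pos m) by rewrite mulrC wt_monoM.
apply: supp_ext => x; rewrite mem_mono; apply/idP/eqP => [/rough_class_dvd[/dvdnP[k xE] xn]|->].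
  apply: val_inj; rewrite /= to_posE // xE; have := pos_gt0 x.
  by case: k xE => [|[|k]] xE; rewrite ?mul1n // xE; nia.
by have := mem_rough_class1 mn; rewrite mul1n.
Qed.

Lemma pfree_mul_rough (p k : nat) : prime p -> (p <= q)%N -> (0 < k)%N ->
  pfree p (to_pos (k * m)) = ~~ (p %| k)%N.
Proof.
move=> pp pq k0; rewrite /pfree to_posE ?muln_gt0 ?k0 // Euclid_dvdM //.
by have /roughP/(_ p pp pq)/negPf-> := m_rough; rewrite orbF.
Qed.

Lemma pfree_prime_mul_rough (p r : nat) : prime p -> prime r -> (p <= q)%N ->
  pfree p (to_pos (r * m)) = (p != r).
Proof. by move=> pp rp pq; rewrite pfree_mul_rough ?prime_gt0 // dvdn_prime2. Qed.

Lemma pfree_one_mul_rough (p : nat) : prime p -> (p <= q)%N -> pfree p (to_pos (1 * m)).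
Proof. by move=> pp pq; rewrite pfree_mul_rough // dvdn1 neq_ltn prime_gt1 ?orbT. Qed.

Lemma to_pos_neq12 : to_pos (1 * m) != to_pos (2 * m) :> nat.
Proof. by rewrite !to_posE; lia. Qed.

Lemma wt_class2 X : X != 0 -> (2 * m <= n)%N -> (2 <= wt (X * rough_class))%N.
Proof.
move=> X0 mn; apply: (wt_mul_ge2 X0) to_pos_neq12; last first.
  by apply: mem_rough_class_prime => //; apply: prime_gt1.
by apply: mem_rough_class1; lia.
Qed.

Lemma wt_restr2 X (p : nat) : X != 0 -> prime p -> (2 < p <= q)%N -> (2 * m <= n)%N ->
  (2 <= wt (X * restr (pfree p) rough_class))%N.
Proof.
move=> X0 pp /andP[p2 pq] mn; apply: (wt_mul_ge2 X0) to_pos_neq12.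
  by rewrite mem_restr pfree_one_mul_rough //= mem_rough_class1 //; lia.
rewrite mem_restr pfree_prime_mul_rough // mem_rough_class_prime //; first by lia.
exact: prime_gt1.
Qed.

Lemma wt_class3 X : X != 0 -> (3 <= q)%N -> (3 * m <= n)%N -> (3 <= wt (X * rough_class))%N.
Proof.
move=> X0 q3 mn.
have [||||X' X'0 le] := @wt_extreme_levels 3 X rough_class (to_pos (1 * m)) (to_pos (3 * m)) isT X0.
- by apply: mem_rough_class1; lia.
- exact: pfree_one_mul_rough.
- exact: mem_rough_class_prime.
- by rewrite pfree_prime_mul_rough.
by apply: leq_trans le; rewrite add1n ltnS wt_restr2 //; lia.
Qed.

(** The terms m, 2m, 3m, qm are present.  Use the levels at q, then at 3, each
    time gaining one term, and finish with m and 2m. *)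
Lemma wt_class4 X : X != 0 -> (5 <= q)%N -> (q * m <= n)%N -> (4 <= wt (X * rough_class))%N.
Proof.
move=> X0 q5 mn.
have mn' : (3 * m <= n)%N by nia.
have [||||X' X'0 le] := @wt_extreme_levels q X rough_class (to_pos (1 * m)) (to_pos (q * m)) qp X0.
- by apply: mem_rough_class1; lia.
- exact: pfree_one_mul_rough.
- exact: mem_rough_class_prime.
- by rewrite pfree_prime_mul_rough ?eqxx.
have fq k : prime k -> (k < q)%N -> (k * m <= n)%N ->
    to_pos (k * m) \in supp (restr (pfree q) rough_class).
  move=> kp kq kn; rewrite mem_restr pfree_prime_mul_rough // mem_rough_class_prime //;
    last exact: ltnW.
  by rewrite andbT neq_ltn kq orbT.
have f1 : to_pos (1 * m) \in supp (restr (pfree q) rough_class).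
  by rewrite mem_restr pfree_one_mul_rough //= mem_rough_class1 //; lia.
have [||||X2 X20 le2] :=
    @wt_extreme_levels 3 X' (restr (pfree q) rough_class)
      (to_pos (1 * m)) (to_pos (3 * m)) isT X'0.
- exact: f1.
- by apply: pfree_one_mul_rough => //; lia.
- by apply: fq => //; lia.
- by rewrite pfree_prime_mul_rough //; lia.
have : (2 <= wt (X2 * restr (pfree 3) (restr (pfree q) rough_class)))%N.
  apply: (wt_mul_ge2 X20) to_pos_neq12; rewrite mem_restr ?f1 ?fq ?andbT //; try lia.
    by apply: pfree_one_mul_rough => //; lia.
  by rewrite pfree_prime_mul_rough //; lia.
lia.
Qed.

(** If q * m > n the class is prime to q, so the two halves of X at q multiply
    into disjoint sets. *)
Lemma wt_double X : (n < q * m)%N ->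
  wt (X * rough_class) = (wt (restr (pfree q) X * rough_class) +
                          wt (restr (predC (pfree q)) X * rough_class))%N.
Proof.
move=> nqm; apply: wt_mul_pfree => // x /rough_class_dvd[/dvdnP[k xE] xn].
rewrite /pfree xE Euclid_dvdM // negb_or; have /roughP/(_ q qp (leqnn q))-> := m_rough.
rewrite andbT; apply/negP => /dvdn_leq; have := pos_gt0 x.
rewrite xE muln_gt0 => /andP[k0 _] /(_ k0) qk; rewrite xE in xn; nia.
Qed.

End OneClass.

Section Classes.

Variables (n q : nat) (A : R).
Hypothesis smooth : forall x p, x \in supp A -> prime p -> (p %| x)%N -> (p <= q)%N.

(** When all terms of A have only prime factors <= q, the rough part of a product
    is that of the factor coming from f, so classes cannot overlap. *)
Lemma wt_rough_classes :
  (\sum_(m <- iota 1 n | rough q m) wt (A * rough_class n q m) <= wt (A * segment n))%N.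
Proof.
rewrite -big_filter.
apply: leq_trans (@wt_classes nat [seq m <- iota 1 n | rough q m]
   (fun m x => rpart q x == m) (A * segment n) _).
  apply: leq_sum => m _; rewrite (@restrM _ (fun x => rpart q x == m)) //.
  move=> x y xA _ /=; rewrite rpartM ?pos_gt0 // [rpart q x]rpart_smooth ?pos_gt0 ?mul1n //.
  by move=> p; apply: smooth.
move=> x _; apply: count_le1; first by rewrite filter_uniq ?iota_uniq.
by move=> u v _ _ /eqP <- /eqP <-.
Qed.

End Classes.

End RoughClasses.

Definition Phi (q n : nat) : nat := count (rough q) (iota 1 n).

Lemma Phi_sum (q n : nat) : Phi q n = \sum_(m <- iota 1 n | rough q m) 1.
Proof. by rewrite sum1_count. Qed.

(** The numbers Phi q (n / k) are written as sums over the rough m <= n in order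
    to compare class by class. *)
Lemma Phi_div (q n k : nat) : (0 < k)%N ->
  Phi q (n %/ k) = (\sum_(m <- iota 1 n | rough q m) (k * m <= n : nat))%N.
Proof.
move=> k0; have nk : (n %/ k <= n)%N by apply: leq_div.
have -> : iota 1 n = iota 1 (n %/ k) ++ iota (1 + n %/ k) (n - n %/ k).
  by rewrite -iotaD subnKC.
rewrite big_cat /= [X in (_ + X)%N]big1_seq ?addn0; last first.
  move=> m /andP[_]; rewrite mem_iota => /andP[m1 _].
  by apply/eqP; rewrite eqb0 -ltnNge mulnC -ltn_divLR // -add1n.
rewrite Phi_sum big_seq_cond [RHS]big_seq_cond; apply: eq_bigr => m.
rewrite mem_iota => /andP[/andP[_] + _]; rewrite add1n ltnS mulnC -leq_divRL // => ->.
by [].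
Qed.

(** The arithmetic constraints on a counterexample: s is the number of terms of
    the minimal multiplier A, L < n the weight of f * A, and q the largest prime
    dividing a term of A.  The inequalities depending on q sum up lower bounds for
    the rough classes: s terms for n/2 < m <= n and, for smaller m, 2 terms if
    q = 2, at least 4 (or 3 if m <= n/3) if q = 3, and 4, 6, 4 terms for m in
    (n/3, n/2], (n/q, n/3] and [1, n/q] if q >= 5. *)
Definition multiplier_data (n s q L : nat) : Prop :=
  [/\ prime q, (3 <= s)%N, (L < n)%N & (q * L <= 2 * n * s)%N] /\
  [/\ (q = 2)%N -> (s * Phi q n + 2 * Phi q (n %/ 2) <= L + s * Phi q (n %/ 2))%N,
      (q = 3)%N -> (s * Phi q n + 4 * Phi q (n %/ 2) <=
                    L + s * Phi q (n %/ 2) + Phi q (n %/ 3))%N &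
      (5 <= q)%N -> (s * Phi q n + 4 * Phi q (n %/ 2) + 2 * Phi q (n %/ 3) <=
                     L + s * Phi q (n %/ 2) + 2 * Phi q (n %/ q))%N].

(** * From a light multiple to arithmetic constraints *)

Section MinimalMultiple.

Implicit Types (A B C X g h : R) (x y z : pos) (Q : pred pos).

Section Reduction.

Variables (n r : nat) (P : seq pos).
Hypothesis n_gt1 : (1 < n)%N.
Hypothesis uP : uniq P.
Hypothesis PP : forall p, p \in P -> [/\ prime p, (p <= n)%N & (n < 2 * p)%N].
Hypothesis nr : (n < r.+1 * r.+1)%N.
Hypothesis rP : (r < size P)%N.
Hypothesis arith : forall s q L, (s * size P <= L)%N -> multiplier_data n s q L -> False.

Section Min.
Variable A : R.
Hypothesis A0 : A != 0.
Hypothesis wt_min : forall B, B != 0 -> (wt (segment n * A) <= wt (segment n * B))%N.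
Hypothesis maxel_min : forall B, B != 0 -> (wt (segment n * B) <= wt (segment n * A))%N ->
  (maxel A <= maxel B)%N.
Hypothesis small : (wt (segment n * A) < n)%N.

Let sP := few_terms n_gt1 A0 wt_min maxel_min uP PP nr rP.

Lemma prime_splits (p : nat) x : prime p -> x \in supp A -> (p %| x)%N ->
  [/\ restr (pfree p) A != 0, restr (predC (pfree p)) A != 0 &
      (p * wt (segment n * A) <= 2 * n * wt A)%N].
Proof.
move=> pp xA px; have A1 : restr (predC (pfree p)) A != 0.
  by apply: (restr_neq0 xA); rewrite /= /pfree px.
have A2 : restr (pfree p) A != 0.
  apply: contraPneq (@not_all_dvd n A A0 maxel_min (to_pos p) _) => [A2|]; last first.
    by rewrite to_posE // prime_gt0.
  move=> nd; apply: nd => y yA; rewrite to_posE ?prime_gt0 //.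
  apply/negPn/negP => py; have : y \in supp (restr (pfree p) A).
    by rewrite mem_restr yA /pfree py.
  by rewrite A2 supp0 inE.
split=> //; have := two_halves pp A2 A1 wt_min.
have := leq_divM n p; nia.
Qed.

(** With one term the multiple has weight n, with two terms [wt_pair] applies. *)
Lemma wtA_ge3 : (3 <= wt A)%N.
Proof.
have : (0 < wt A)%N by rewrite wt_gt0.
case E : (wt A) => [|[|[|s]]] // _; move: small; rewrite ltnNge => /negP[].
  by have [x ->] := wt1_mono E; rewrite mulrC wt_monoM wt_segment.
by have [x [y [xy ->]]] := wt2_pair E; apply: wt_pair.
Qed.

(** If no prime divided a term of A, then A would be the monomial 1. *)
Lemma max_prime : exists q, [/\ prime q, exists2 x, x \in supp A & (q %| x)%N &
  forall x p, x \in supp A -> prime p -> (p %| x)%N -> (p <= q)%N].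
Proof.
have [x xA xM] := ex_max (fun x : pos => max_pdiv x) A0.
case: (ltnP 1 x) => x1.
  exists (max_pdiv x); split; first exact: max_pdiv_prime.
    by exists x => //; apply: max_pdiv_dvd.
  move=> y p yA pp py; apply: leq_trans (xM y yA); apply: max_pdiv_max.
  by rewrite mem_primes pp pos_gt0.
have A1 y : y \in supp A -> y = pone.
  move=> /[dup] yA /xM; have -> : max_pdiv x = 1%N.
    by case: (x : nat) x1 (pos_gt0 x) => [|[|]].
  case: (ltnP 1 y) => y1.
    by have := prime_gt1 (max_pdiv_prime y1); case: (max_pdiv y) => [|[|]].
  by move=> _; apply: val_inj => /=; have := pos_gt0 y; move: y1; case: (y : nat) => [|[|]].
have := wtA_ge3; suff -> : A = mono pone by rewrite wt_mono.
apply: supp_ext => y; rewrite mem_mono; apply/idP/eqP => [/A1//|->].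
by rewrite -(A1 x xA).
Qed.

Lemma no_light_minimal_multiple : False.
Proof.
have [q [qp [x xA qx] qM]] := max_prime.
have [A1 A2 qL] := prime_splits qp xA qx.
have s3 := wtA_ge3.
apply: (@arith (wt A) q (wt (segment n * A))); first by rewrite mulnC sP.
split; first by split.
have cl := wt_rough_classes n qM; rewrite [A * segment n]mulrC in cl.
have rng m : m \in iota 1 n -> (0 < m)%N /\ (m <= n)%N.
  by rewrite mem_iota => /andP[m0]; rewrite add1n ltnS.
set s := wt A in s3 *; set L := wt (segment n * A) in cl *.
have E0 : (s * Phi q n = \sum_(m <- iota 1 n | rough q m) s)%N.
  by rewrite Phi_sum big_distrr /=; apply: eq_bigr => m _; rewrite muln1.
have Ek c k : (0 < k)%N -> (c * Phi q (n %/ k) =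
    \sum_(m <- iota 1 n | rough q m) c * (k * m <= n : nat))%N.
  by move=> k0; rewrite Phi_div // big_distrr.
have cmp (a b c d : nat) : (a <= b)%N -> (d <= a + c)%N -> (d <= b + c)%N by lia.
have sumle (f g : nat -> nat) :
    (forall m, (0 < m)%N -> (m <= n)%N -> rough q m -> (f m <= g m)%N) ->
    (\sum_(m <- iota 1 n | rough q m) f m <= \sum_(m <- iota 1 n | rough q m) g m)%N.
  move=> fg; rewrite big_seq_cond [X in (_ <= X)%N]big_seq_cond.
  by apply: leq_sum => m /andP[/rng[m0 mn] mr]; apply: fg.
split.
- move=> q2; rewrite E0 !Ek // -big_split /=.
  apply: (cmp _ _ _ _ cl); rewrite -big_split /=; apply: sumle => m m0 mn mr.
  case: (leqP (2 * m) n) => mn2; last by rewrite wt_class1 //; lia.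
  by have := wt_class2 qp m0 mr A0 mn2; lia.
- move=> q3; rewrite E0 !Ek // -big_split /=.
  have := Ek 1%N 3 isT; rewrite mul1n => ->.
  rewrite -addnA; apply: (cmp _ _ _ _ cl); rewrite -!big_split /=.
  apply: sumle => m m0 mn mr.
  case: (leqP (2 * m) n) => mn2; last by rewrite wt_class1 //; lia.
  case: (leqP (3 * m) n) => mn3.
    by have := @wt_class3 n q m qp m0 mr A A0; rewrite q3 => /(_ isT mn3); lia.
  rewrite wt_double // ?q3 //.
  have := wt_class2 qp m0 mr A1 mn2; have := wt_class2 qp m0 mr A2 mn2.
  by rewrite q3; lia.
move=> q5; rewrite E0 !Ek ?prime_gt0 // -!big_split /=.
rewrite -addnA; apply: (cmp _ _ _ _ cl); rewrite -!big_split /=.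
apply: sumle => m m0 mn mr.
case: (leqP (2 * m) n) => mn2; last first.
  by rewrite wt_class1 //; lia.
case: (leqP (q * m) n) => mnq.
  have := wt_class4 qp m0 mr A0 q5 mnq.
  by case: (leqP (3 * m) n); lia.
rewrite wt_double //.
case: (leqP (3 * m) n) => mn3.
  have := wt_class3 qp m0 mr A1 (leq_trans _ q5) mn3.
  have := wt_class3 qp m0 mr A2 (leq_trans _ q5) mn3; lia.
have := wt_class2 qp m0 mr A1 mn2; have := wt_class2 qp m0 mr A2 mn2; lia.
Qed.

End Min.

(** The double induction produces a counterexample that is minimal first for its
    weight, then for the largest term of its multiplier. *)
Theorem weight_bound A : A != 0 -> (n <= wt (segment n * A))%N.
Proof.
have [w] := ubnP (wt (segment n * A)); elim: w A => // w IHw A.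
have [m] := ubnP (maxel A); elim: m A => // m IHm A mA wA A0.
rewrite leqNgt; apply/negP => small; apply: (@no_light_minimal_multiple A A0) => // B B0.
  rewrite leqNgt; apply/negP => BA.
  have : (n <= wt (segment n * B))%N by apply: IHw => //; lia.
  lia.
move=> BA; rewrite leqNgt; apply/negP => mBA.
have : (n <= wt (segment n * B))%N by apply: IHm => //; lia.
lia.
Qed.

End Reduction.

End MinimalMultiple.

(** * The Legendre sieve and densities *)

Definition sfree (s : seq nat) : pred nat := fun m => all (fun p => ~~ (p %| m)%N) s.
Definition sieve (s : seq nat) (x : nat) : nat := count (sfree s) (iota 1 x).
Section Density.
Variable K : realFieldType.

Definition density (s : seq nat) : K := \prod_(p <- s) (1 - p%:R^-1).

Lemma sieveS s x : sieve s x.+1 = (sieve s x + sfree s x.+1)%N.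
Proof. by rewrite /sieve -[x.+1]addn1 iotaD count_cat /= addn0 add1n addn1. Qed.

Lemma sieve_le s x y : (x <= y)%N -> (sieve s x <= sieve s y)%N.
Proof. by move=> xy; rewrite /sieve -(subnKC xy) iotaD count_cat leq_addr. Qed.

(** Legendre's recursion: the integers removed by p are the multiples p * k with k
    surviving the previous primes. *)
Lemma sieve_cons p s x : prime p -> all prime s -> p \notin s ->
  (sieve (p :: s) x + sieve s (x %/ p) = sieve s x)%N.
Proof.
move=> pp sp ps; elim: x => [|x IHx]; first by rewrite div0n.
rewrite !sieveS -IHx divnS ?prime_gt0 //=.
case: (boolP (p %| x.+1)%N) => pd /=; last by rewrite add0n addnAC.
rewrite addn0 add1n sieveS -!addnA; congr (_ + (_ + _))%N.
have xE : x.+1 = (p * (x %/ p).+1)%N.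
  by rewrite -(divnK pd) divnS ?prime_gt0 // pd mulnC.
congr nat_of_bool; rewrite [in RHS]xE; apply: eq_in_all => r rs.
have rp := allP sp r rs; rewrite Euclid_dvdM // negb_or (dvdn_prime2 rp pp).
have -> : (r == p) = false by apply: contraNF ps => /eqP <-.
by [].
Qed.

Lemma density_bounds s : all prime s -> 0 < density s <= 1.
Proof.
rewrite /density; elim: s => [|p s IHs] /=; first by rewrite big_nil; lra.
move=> /andP[pp /IHs /andP[d0 d1]]; rewrite big_cons.
have p1 : 0 < (p%:R^-1 : K) < 1.
  have pR : (1 : K) < p%:R by rewrite ltr1n prime_gt1.
  by apply/andP; split; [rewrite invr_gt0|rewrite invf_lt1 //]; lra.
by apply/andP; split; nra.
Qed.

Lemma divn_bounds (x p : nat) : (0 < p)%N ->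
  x%:R / p%:R - 1 <= ((x %/ p)%:R : K) <= x%:R / p%:R.
Proof.
move=> p0; have p0' : 0 < (p%:R : K) by rewrite ltr0n.
have xE : x%:R = (x %/ p)%:R * p%:R + (x %% p)%:R :> K.
  by rewrite -natrM -natrD -divn_eq.
have m0 : 0 <= ((x %% p)%:R : K) by [].
have mp : ((x %% p)%:R : K) < p%:R by rewrite ltr_nat ltn_mod.
by rewrite lerBlDr ler_pdivrMr // ler_pdivlMr // xE; apply/andP; split; nra.
Qed.

(** The error at most doubles with each further prime, plus one rounding error. *)
Lemma sieve_bounds s x : all prime s -> uniq s ->
  density s * x%:R - 2 ^+ size s + 1 <= ((sieve s x)%:R : K) <=
  density s * x%:R + 2 ^+ size s - 1.
Proof.
elim: s x => [|p s IHs] x /=.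
  by move=> _ _; rewrite /density /sieve big_nil count_predT size_iota; lra.
move=> /andP[pp sp] /andP[ps us].
have [/andP[l1 u1] /andP[l2 u2]] := (IHs x sp us, IHs (x %/ p)%N sp us).
have := sieve_cons x pp sp ps => /(congr1 (fun k : nat => k%:R : K)).
rewrite natrD => E.
have /andP[d0 d1] := density_bounds sp.
have /andP[b1 b2] := divn_bounds x (prime_gt0 pp).
have -> : density (p :: s) = density s - density s / p%:R.
  by rewrite /density big_cons; ring.
have e2 : density s * (x %/ p)%:R <= density s * (x%:R / p%:R) by rewrite ler_pM2l.
have e1 : density s * (x%:R / p%:R) - 1 <= density s * (x %/ p)%:R by nra.
rewrite exprS mulrBl -mulrA [p%:R^-1 * _]mulrC; lra.
Qed.

Lemma sieve_mono_interval s s' x y : {subset s <= s'} -> (x <= y)%N ->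
  (sieve s' y + sieve s x <= sieve s y + sieve s' x)%N.
Proof.
move=> ss xy; rewrite /sieve -(subnKC xy) !iotaD !count_cat.
have : (count (sfree s') (iota (1 + x) (y - x)) <=
        count (sfree s) (iota (1 + x) (y - x)))%N.
  by apply: sub_count => m /allP sm; apply/allP => p /ss; apply: sm.
by lia.
Qed.

(** Union bound: on (x, y], sieving further by the primes of t removes at most,
    for each p in t, the multiples p * k with k surviving s.  This avoids the
    exponential error of the full sieve. *)
Lemma sieve_cat_ge t s x y : all prime t -> all prime s -> uniq (t ++ s) -> (x <= y)%N ->
  (sieve s y + sieve (t ++ s) x <= sieve (t ++ s) y + sieve s x +
    \sum_(p <- t) (sieve s (y %/ p) - sieve s (x %/ p)))%N.
Proof.
move=> + sp + xy; elim: t => [|p t IHt] /=; first by rewrite big_nil addn0.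
move=> /andP[pp tp] /andP[pN u]; have {}IHt := IHt tp u.
have tsp : all prime (t ++ s) by rewrite all_cat tp.
rewrite big_cons.
have E1 := sieve_cons y pp tsp pN; have E2 := sieve_cons x pp tsp pN.
have xyp : (x %/ p <= y %/ p)%N by apply: leq_div2r.
have sts : {subset s <= t ++ s} by move=> r rs; rewrite mem_cat rs orbT.
have M := sieve_mono_interval sts xyp.
have := sieve_le s xyp; lia.
Qed.

Definition primes_upto (z : nat) : seq nat := [seq p <- iota 0 z.+1 | prime p].

Lemma Phi_sieve q n : Phi q n = sieve (primes_upto q) n.
Proof. by []. Qed.

Lemma primes_upto_prime z : all prime (primes_upto z).
Proof. exact: filter_all. Qed.

Lemma primes_upto_uniq z : uniq (primes_upto z).
Proof. by rewrite filter_uniq ?iota_uniq. Qed.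

Lemma primes_uptoS z :
  primes_upto z.+1 = primes_upto z ++ (if prime z.+1 then [:: z.+1] else [::]).
Proof. by rewrite /primes_upto -[z.+2]addn1 iotaD filter_cat. Qed.

Lemma density_cat s t : density (s ++ t) = density s * density t.
Proof. by rewrite /density big_cat. Qed.

Lemma density_uptoS z : density (primes_upto z.+1) =
  if prime z.+1 then density (primes_upto z) * (1 - z.+1%:R^-1) else density (primes_upto z).
Proof.
rewrite primes_uptoS; case: ifP => _; last by rewrite cats0.
by rewrite density_cat /density big_seq1.
Qed.

Definition dens z : K := density (primes_upto z).

Lemma densE z : dens z = density (primes_upto z).
Proof. by []. Qed.

Lemma dens_gt0 z : 0 < dens z.
Proof. by rewrite densE; case/andP: (density_bounds (primes_upto_prime z)). Qed.

Lemma densS z : dens z.+1 = if prime z.+1 then dens z * (1 - z.+1%:R^-1) else dens z.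
Proof. by rewrite !densE density_uptoS. Qed.

Lemma dens29 : dens 29 =
  1/2 * (2/3) * (4/5) * (6/7) * (10/11) * (12/13) * (16/17) * (18/19) * (22/23) * (28/29).
Proof.
have -> : dens 29 = density [:: 2; 3; 5; 7; 11; 13; 17; 19; 23; 29]%N.
  by rewrite densE; congr density.
rewrite /density !big_cons big_nil; lra.
Qed.

(** z * dens z increases when z + 1 is composite and is unchanged when z + 1 is
    prime; its value at 29 exceeds 9/2. *)
Lemma dens_mul_ge z : (29 <= z)%N -> 9/2 <= z%:R * dens z.
Proof.
elim: z => [z0|z IHz]; first by exfalso; move: z0; rewrite ltn0.
rewrite leq_eqVlt => /orP[/eqP <-|/IHz {IHz} IH]; first (rewrite dens29; lra).
have d0 := dens_gt0 z; have z0 : 0 <= (z%:R : K) by rewrite ler0n.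
have zE : z.+1%:R = z%:R + 1 :> K by rewrite natr1.
rewrite densS; case: ifP => _; last by rewrite zE; nra.
have -> : z.+1%:R * (dens z * (1 - z.+1%:R^-1)) = z%:R * dens z.
  by rewrite zE; field; lra.
exact: IH.
Qed.

(** For odd z only z + 2 among z + 1 and z + 2 can be prime, and
    (z + 1)^2 / (z + 2) > z makes z * (dens z)^2 nondecreasing.  This is the decay
    z^(-1/2), much weaker than the truth but enough. *)
Lemma dens_sqr_ge j : (14 <= j)%N -> 18/25 <= (2 * j + 1)%:R * dens (2 * j + 1) ^+ 2.
Proof.
elim: j => [j0|j IHj]; first by exfalso; move: j0; rewrite ltn0.
rewrite leq_eqVlt => /orP[/eqP <-|/[dup] j14 /IHj {IHj} IH].
  have -> : (2 * 14 + 1 = 29)%N by [].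
  rewrite dens29; lra.
set z := (2 * j + 1)%N in IH.
have -> : (2 * j.+1 + 1)%N = z.+2 by rewrite /z; lia.
have np : prime z.+1 = false.
  apply/negP => /even_prime[|]; last by rewrite /z addn1 mul2n /= odd_double.
  by clear IH; rewrite /z; lia.
rewrite densS densS np.
have d0 := dens_gt0 z; have z0 : 1 <= (z%:R : K) by rewrite ler1n /z; lia.
have -> : z.+2%:R = z%:R + 2 :> K by rewrite -addn2 natrD.
move: IH d0 z0; set w := z%:R; set d := dens z => IH d0 z0.
case: ifP => _; apply: le_trans IH _.
  have -> : (w + 2) * (d * (1 - (w + 2)^-1)) ^+ 2 = (w + 1) ^+ 2 / (w + 2) * d ^+ 2.
    by field; lra.
  by rewrite ler_pM2r ?exprn_gt0 // ler_pdivlMr; nra.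
by rewrite ler_pM2r ?exprn_gt0 //; lra.
Qed.

End Density.

(** * Primes in the upper half *)

Section Bertrand.
Local Open Scope nat_scope.

Lemma central_bin m : 4 ^ m <= (2 * m + 1) * 'C(2 * m, m).
Proof.
elim: m => // m IHm.
have e1 : (m.+1) * 'C(2 * m + 2, m.+1) = (2 * m + 2) * 'C(2 * m + 1, m).
  by rewrite -mul_bin_diag addn2 addn1.
have e2 : (m.+1) * 'C(2 * m + 1, m) = (2 * m + 1) * 'C(2 * m, m).
  have := mul_bin_left (2 * m + 1) m; have := mul_bin_diag (2 * m + 1) m.
  rewrite addn1 /= => d l.
  have -> : m.+1 = (2 * m).+1 - m by lia.
  by rewrite mul_bin_down.
have -> : 2 * m.+1 = 2 * m + 2 by lia.
have E : m.+1 * (m.+1 * 'C(2 * m + 2, m.+1)) =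
    (2 * m + 2) * ((2 * m + 1) * 'C(2 * m, m)).
  by rewrite e1 mulnCA e2.
rewrite expnS; move: IHm E; set a := 'C(_, m); set b := 'C(_, _); set c := 4 ^ m.
move=> IH E; have {}E : m.+1 * b = 2 * ((2 * m + 1) * a) by nia.
nia.
Qed.

Lemma half_bin n : 2 ^ n <= (n + 1) * 'C(n, n./2).
Proof.
have nE := odd_double_half n; set m := n./2 in nE *.
case: (odd n) nE => /= nE; last first.
  rewrite -nE add0n -muln2 mulnC expnM; exact: central_bin.
have {nE} -> : n = (2 * m).+1 by rewrite -nE -mul2n.
have e2 : (m.+1) * 'C((2 * m).+1, m) = (2 * m + 1) * 'C(2 * m, m).
  have -> : m.+1 = (2 * m).+1 - m by lia.
  by rewrite -mul_bin_down /= addn1.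
have := central_bin m; rewrite expnS expnM -[2 ^ 2]/4; nia.
Qed.

Definition primorial x := \prod_(p <- iota 0 x.+1 | prime p) p.

Lemma prod_primes_dvd (s : seq nat) N : uniq s -> all prime s ->
  (forall p, p \in s -> p %| N) -> \prod_(p <- s) p %| N.
Proof.
elim: s => [|p s IHs] /=; first by rewrite big_nil dvd1n.
move=> /andP[ps us] /andP[pp sp] dN; rewrite big_cons Gauss_dvd.
  by rewrite dN ?mem_head // IHs // => r rs; apply: dN; rewrite inE rs orbT.
rewrite prime_coprime // Euclid_dvd_prod // big_has; apply/hasP => -[r rs /=].
by rewrite dvdn_prime2 ?(allP sp r) // => /eqP pr; rewrite pr rs in ps.
Qed.

Lemma bin_odd_le k : 'C((2 * k).+1, k) <= 4 ^ k.
Proof.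
have e : 'C((2 * k).+1, k.+1) = 'C((2 * k).+1, k).
  by rewrite -[RHS]bin_sub; [congr 'C(_, _)|]; lia.
have : 'C((2 * k).+1, k) + 'C((2 * k).+1, k.+1) <= 2 ^ (2 * k).+1.
  have := Pascal 1 1 (2 * k).+1.
  rewrite (_ : 1 + 1 = 2) // => ->.
  have k1 : k < (2 * k).+2 by lia. have k2 : k.+1 < (2 * k).+2 by lia.
  rewrite (bigD1 (Ordinal k1)) //= (bigD1 (Ordinal k2)) /=; last first.
    by rewrite -val_eqE /=; lia.
  by rewrite !exp1n !muln1 addnA leq_addr.
by rewrite e expnS expnM -[2 ^ 2]/4; lia.
Qed.

Lemma prime_dvd_fact p j : prime p -> (p %| j`!) = (p <= j).
Proof.
move=> pp; elim: j => [|j IHj].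
  by rewrite fact0 dvdn1 leqn0; have := prime_gt1 pp; case: p pp => [|[|]].
rewrite factS Euclid_dvdM // IHj [in RHS]leq_eqVlt ltnS.
case: (leqP p j) => pj; rewrite ?orbT // !orbF; apply/idP/eqP => [|->//].
by move/dvdn_leq; lia.
Qed.

(** Erdos' argument: for y = 2k + 1 the primes in (k + 1, y] divide the binomial
    coefficient bounded in [bin_odd_le]. *)
Lemma primorial_le x : primorial x <= 4 ^ x.
Proof.
have [m] := ubnP x; elim: m x => // m IHm x xm.
case: x xm => [|[|[|x]]] xm; try by rewrite /primorial /= !big_cons big_nil.
set y := x.+3 in xm *.
case: (boolP (odd y)) => yo; last first.
  have -> : primorial y = primorial x.+2.
    rewrite /primorial -[y.+1]addn1 iotaD big_cat /= [X in _ * X]big_cons big_nil.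
    rewrite add0n ifN ?muln1 //.
    by apply/negP => /even_prime[|]; [rewrite /y; lia|apply/negP].
  by apply: leq_trans (IHm x.+2 _) _; [lia|rewrite leq_exp2l].
have yE := odd_double_half y; rewrite yo add1n in yE.
set k := y./2 in yE; have {}yE : y = (2 * k).+1 by rewrite -yE mul2n.
have k0 : 0 < k by lia.
have -> : primorial y = primorial k.+1 * \prod_(p <- iota k.+2 k | prime p) p.
  rewrite /primorial -big_cat; congr (\big[_/_]_(_ <- _ | _) _).
  have -> : y.+1 = k.+2 + k by lia.
  by rewrite iotaD.
have -> : 4 ^ y = 4 ^ k.+1 * 4 ^ k by rewrite -expnD; congr (_ ^ _); lia.
apply: leq_mul; first by apply: IHm; lia.
apply: leq_trans (bin_odd_le k); rewrite -big_filter; apply: dvdn_leq.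
  by rewrite bin_gt0; lia.
apply: prod_primes_dvd; rewrite ?filter_uniq ?iota_uniq ?filter_all // => p.
rewrite mem_filter mem_iota => /andP[pp /andP[p1 p2]].
have := bin_fact (_ : k <= (2 * k).+1) => /(_ ltac:(lia)) E.
have : p %| ((2 * k).+1)`! by rewrite dvdn_fact //; lia.
rewrite -E Euclid_dvdM // Euclid_dvdM //.
have nf j : j < p -> (p %| j`!) = false.
  by move=> jp; rewrite prime_dvd_fact // leqNgt jp.
by rewrite !nf ?orbF //; lia.
Qed.

Lemma bin_logn n m p : prime p -> m <= n ->
  logn p 'C(n, m) = \sum_(1 <= k < n.+1) (n %/ p ^ k - m %/ p ^ k - (n - m) %/ p ^ k) /\
  forall k, n %/ p ^ k <= m %/ p ^ k + (n - m) %/ p ^ k + 1 /\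
     m %/ p ^ k + (n - m) %/ p ^ k <= n %/ p ^ k.
Proof.
move=> pp mn.
have bnd k : n %/ p ^ k <= m %/ p ^ k + (n - m) %/ p ^ k + 1 /\
     m %/ p ^ k + (n - m) %/ p ^ k <= n %/ p ^ k.
  have := @divnD m (n - m) (p ^ k); rewrite expn_gt0 prime_gt0 // subnKC // => /(_ isT).
  move: (n %/ p ^ k) (m %/ p ^ k) ((n - m) %/ p ^ k) => a b c.
  by case: (p ^ k <= _) => /= ->; lia.
split=> //; have := bin_fact mn => /(congr1 (logn p)).
rewrite !lognM ?bin_gt0 ?muln_gt0 ?fact_gt0 // !logn_fact //.
have ext j : j <= n -> \sum_(1 <= k < j.+1) j %/ p ^ k = \sum_(1 <= k < n.+1) j %/ p ^ k.
  move=> jn; rewrite [RHS](@big_cat_nat _ _ _ j.+1) //= [X in _ + X]big1_seq ?addn0 //.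
  move=> k; rewrite mem_index_iota => /andP[_ /andP[jk _]]; apply: divn_small.
  by apply: leq_trans jk _; apply/ltnW/ltn_expl/prime_gt1.
rewrite (ext m) // (ext (n - m)) ?leq_subr // -big_split /=.
set S := \sum_(1 <= k < n.+1) (_ - _ - _) => E.
suff : S + \sum_(1 <= k < n.+1) (m %/ p ^ k + (n - m) %/ p ^ k) =
    \sum_(1 <= k < n.+1) n %/ p ^ k by lia.
rewrite /S -big_split /=; apply: eq_bigr => k _; have [_] := bnd k.
by move: (n %/ p ^ k) (m %/ p ^ k) ((n - m) %/ p ^ k) => a b c; lia.
Qed.

(** In Legendre's formula for the valuation each summand is at most 1, and it
    vanishes once p^k > n. *)
Lemma bin_prime_power_le n m p : prime p -> 0 < n -> m <= n -> p ^ logn p 'C(n, m) <= n.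
Proof.
move=> pp n0 mn; have [-> bnd] := bin_logn pp mn.
apply: leq_trans (trunc_logP (prime_gt1 pp) n0).
rewrite leq_exp2l ?prime_gt1 //.
apply: (@leq_trans (\sum_(1 <= k < n.+1) (k <= trunc_log p n))).
  apply: leq_sum => k _; case: (leqP k (trunc_log p n)) => kn.
    have [+ _] := bnd k; move: (n %/ p ^ k) (m %/ p ^ k) ((n - m) %/ p ^ k).
    by move=> a b c /=; lia.
  rewrite divn_small //; apply: leq_trans (trunc_log_ltn n (prime_gt1 pp)) _.
  by rewrite leq_exp2l // prime_gt1.
have : forall t N, \sum_(1 <= k < N.+1) (k <= t) <= t.
  move=> t N; suff : \sum_(1 <= k < N.+1) (k <= t) <= minn t N by lia.
  elim: N => [|N IHN]; first by rewrite big_geq.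
  by rewrite big_nat_recr //=; case: (leqP N.+1 t) => _; lia.
exact.
Qed.

(** For p > sqrt n only the first summand of Legendre's formula remains. *)
Lemma bin_logn_big n m p : prime p -> m <= n -> n < p * p ->
  logn p 'C(n, m) = n %/ p - m %/ p - (n - m) %/ p.
Proof.
move=> pp mn np; have [-> _] := bin_logn pp mn.
case: n mn np => [|n] mn np; first by rewrite big_geq // div0n.
rewrite big_ltn // expn1 big1_seq ?addn0 // => k; rewrite mem_index_iota => /andP[_ /andP[k2 _]].
rewrite divn_small //; apply: leq_trans np _.
by rewrite mulnn leq_exp2l // prime_gt1.
Qed.

Definition upper_primes n := [seq p <- iota n./2.+1 (n - n./2) | prime p].

Lemma prod_if_const (s : seq nat) (b : pred nat) c k :
  0 < c -> count b s <= k -> \prod_(p <- s) (if b p then c else 1) <= c ^ k.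
Proof.
move=> c0 bk; rewrite -big_mkcond big_const_seq iter_muln muln1.
by rewrite leq_pexp2l.
Qed.

Lemma count_le_size (s t : seq nat) (b : pred nat) : uniq s ->
  (forall p, p \in s -> b p -> p \in t) -> count b s <= size t.
Proof.
move=> us bt; rewrite -size_filter; apply: uniq_leq_size; first by rewrite filter_uniq.
by move=> p; rewrite mem_filter => /andP[bp ps]; apply: bt.
Qed.

(** Bound the prime factorization of the middle binomial coefficient.  Each of the
    at most r primes p <= r contributes at most n.  Primes in (r, n/3] occur at
    most once and are absorbed by the primorial of n/3.  Primes in (n/3, n/2] do not
    occur, since n / p = 2 while both halves of n are at least p.  Each prime in
    (n/2, n] contributes at most n. *)
Lemma exp2_le_upper_primes n r : 0 < n -> n < r.+1 * r.+1 ->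
  2 ^ n <= (n + 1) * (n ^ r * 4 ^ (n %/ 3) * n ^ size (upper_primes n)).
Proof.
move=> n0 nr; apply: leq_trans (half_bin n) _; rewrite leq_mul2l; apply/orP; right.
set m := n./2; have mn : m <= n by rewrite /m; lia.
set C := 'C(n, m); pose M := C + n.
(* M only bounds the primes in play, so that the product can be split freely *)
pose b1 p := prime p && (p <= r); pose b2 p := prime p && (p <= n %/ 3).
pose b3 p := prime p && (m < p <= n).
have -> : C = \prod_(p <- iota 0 M.+1) p ^ logn p C.
  by rewrite -[LHS]partnT ?bin_gt0 // (@widen_partn M) ?leq_addr.
apply: (@leq_trans (\prod_(p <- iota 0 M.+1) ((if b1 p then n else 1) *
    (if b2 p then p else 1) * (if b3 p then n else 1)))).
  apply: leq_prod => p _.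
  case: (boolP (prime p)) => pp; last first.
    by rewrite /b1 /b2 /b3 (negPf pp) /= lognE (negPf pp).
  rewrite /b1 /b2 /b3 pp /=; have p0 := prime_gt0 pp.
  have pn := bin_prime_power_le pp n0 mn.
  case: (leqP p r) => pr.
    apply: leq_trans pn _; rewrite -mulnA leq_pmulr // muln_gt0.
    by case: (p <= n %/ 3); case: (m < p <= n); rewrite ?p0 ?n0.
  have npp : n < p * p by apply: leq_trans nr _; rewrite leq_mul.
  have E := bin_logn_big pp mn npp; rewrite -/C in E.
  have := bin_logn pp mn => -[_ /(_ 1)]; rewrite expn1 => -[b _].
  have l1 : logn p C <= 1.
    by rewrite E; move: b; move: (n %/ p) (m %/ p) ((n - m) %/ p); clear; lia.
  rewrite mul1n; case: (leqP p (n %/ 3)) => p3.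
    case: (logn p C) l1 => [|[|]] // _; rewrite ?expn0 ?expn1.
      by rewrite muln_gt0 p0; case: (m < p <= n).
    by case: (m < p <= n); rewrite ?muln1 // leq_pmulr.
  rewrite mul1n; case: (leqP p m) => pm /=; last first.
    case: (leqP p n) => pn'; first by apply: leq_trans pn.
    by rewrite E divn_small.
  have -> : logn p C = 0.
    rewrite E.
    have e1 : n %/ p = 2.
      apply/eqP; rewrite eqn_leq; apply/andP; split.
        by rewrite -ltnS ltn_divLR //; move: p3; rewrite ltn_divLR //; lia.
      by rewrite leq_divRL //; move: pm; rewrite /m; lia.
    have e2 : 1 <= m %/ p by rewrite leq_divRL // mul1n.
    have e3 : 1 <= (n - m) %/ p by rewrite leq_divRL // mul1n; move: pm; rewrite /m; lia.
    by rewrite e1; move: e2 e3; move: (m %/ p) ((n - m) %/ p); clear; lia.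
  by [].
rewrite !big_split; apply: leq_mul; [apply: leq_mul|].
- apply: prod_if_const => //; rewrite -(size_iota 1 r).
  apply: count_le_size (iota_uniq 0 M.+1) _ => p _ /andP[pp pr].
  by rewrite mem_iota prime_gt0 //=; lia.
- apply: leq_trans (primorial_le _); set x := n %/ 3; rewrite -big_mkcond.
  have xM : x.+1 + (M - x) = M.+1 by rewrite /M /x; lia.
  rewrite -xM iotaD big_cat; set t := iota _ (M - x).
  change (\prod_(i <- iota 0 x.+1 | b2 i) i * \prod_(i <- t | b2 i) i <= primorial x).
  rewrite [X in _ * X]big1_seq ?muln1.
    rewrite /primorial big_seq_cond [X in _ <= X]big_seq_cond; apply: eq_leq.
    apply: eq_bigl => p; rewrite mem_iota add0n ltnS /= /b2 -/x.
    by case: (p <= x); rewrite ?andbT ?andbF.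
  by move=> p /andP[/andP[_ px]]; rewrite /t mem_iota; move: px; rewrite -/x; lia.
apply: prod_if_const => //; apply: count_le_size (iota_uniq 0 M.+1) _ => p _.
by case/andP=> pp /andP[mp pn]; rewrite mem_filter pp mem_iota -/m mp addSn subnKC ?ltnS.
Qed.

End Bertrand.

(** * Consequences of n being large *)

Section Growth.
Local Open Scope nat_scope.

Lemma exists_sqrt n : exists r, r * r <= n /\ n < r.+1 * r.+1.
Proof.
elim: n => [|n [r [rn nr]]]; first by exists 0.
case: (ltnP n.+1 (r.+1 * r.+1)) => h; first by exists r; split => //; lia.
by exists r.+1; split => //; nia.
Qed.

Lemma sqr_growth (x : nat) : 128 <= x -> x.+1 * x.+1 * (x.+1 * x.+1) <= 2 * (x * x * (x * x)).
Proof.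
move=> x1; set S := x * x; set T := x.+1 * x.+1.
have TS : 100 * T <= 102 * S by rewrite /S /T; nia.
nia.
Qed.

Lemma quartic_lt_exp i :
  1001 * (128 + i) ^ 2 * (1001 * (128 + i) ^ 2) <= 2 ^ (50 + i).
Proof.
rewrite -mulnn mulnACA.
have c : 1001 * 1001 <= 2 ^ 10 * 2 ^ 10 by apply: leq_mul.
apply: leq_trans (leq_mul c (leqnn _)) _.
have {c} -> : 50 + i = 10 + 10 + (30 + i) by lia.
rewrite !expnD leq_mul2l; apply/orP; right.
rewrite -expnD; elim: i => [|i IHi].
  have -> : 128 + 0 = 2 ^ 7 by [].
  by rewrite -!expnD leq_exp2l.
have -> : 30 + i.+1 = (30 + i).+1 by lia.
have -> : 128 + i.+1 = (128 + i).+1 by lia.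
rewrite expnS; apply: leq_trans (sqr_growth _) _; first by lia.
by rewrite leq_mul2l.
Qed.

Lemma sqr_lt_exp i : 100 * 100 * ((32 + i) * (32 + i)) <= 2 ^ (32 + i).
Proof.
elim: i => [|i IHi].
  have c : 100 * 100 <= 2 ^ 7 * 2 ^ 7 by apply: leq_mul.
  apply: leq_trans (leq_mul c (leqnn _)) _.
  have -> : 32 + 0 = 2 ^ 5 by [].
  by rewrite -!expnD leq_exp2l.
have -> : 32 + i.+1 = (32 + i).+1 by lia.
rewrite expnS; move: IHi; set t := 32 + i; set u := 2 ^ t => IHi.
have t1 : 32 <= t by rewrite /t; lia.
nia.
Qed.

Variables (n l r : nat).
Hypothesis l127 : 127 <= l.
Hypothesis nl : 2 ^ l <= n.
Hypothesis nl' : n < 2 ^ l.+1.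
Hypothesis rn : r * r <= n.
Hypothesis nr : n < r.+1 * r.+1.

Let x := l.+1.
Let u := size (upper_primes n).

Lemma n_gt0 : 0 < n.
Proof. by apply: leq_trans nl; rewrite expn_gt0. Qed.

(** A factor above 300 makes the error term 3 * x * (1 + r) below at most
    n / (100 * x). *)
Lemma sqrt_ge : 1001 * x ^ 2 <= r.
Proof.
have [i lE] : exists i, x = 128 + i by exists (x - 128); rewrite /x; lia.
have := quartic_lt_exp i; rewrite -lE => q.
rewrite leqNgt; apply/negP => h.
have : r.+1 * r.+1 <= 2 ^ l.
  apply: leq_trans (leq_mul h h) (leq_trans q _).
  by rewrite leq_exp2l // -ltnS -/x; lia.
by move: nl nr; lia.
Qed.

Lemma le_upper_primes_log : n <= x * (1 + r + u) + 2 * (n %/ 3).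
Proof.
have := exp2_le_upper_primes n_gt0 nr; rewrite -/u => b.
rewrite -(@leq_exp2l 2) //; apply: leq_trans b _.
have n1 : n + 1 <= 2 ^ x by rewrite addn1.
have nx : n <= 2 ^ x by apply: leq_trans n1; rewrite leq_addr.
have pw (e : nat) : n ^ e <= (2 ^ x) ^ e by case: e => // e; rewrite leq_exp2r.
apply: (@leq_trans (2 ^ x * ((2 ^ x) ^ r * 2 ^ (2 * (n %/ 3)) * (2 ^ x) ^ u))).
  by apply: leq_mul n1 (leq_mul (leq_mul (pw r) _) (pw u)); rewrite expnM.
by rewrite -!expnM -!expnD leq_exp2l //; lia.
Qed.

(** Otherwise n <= 3 * x * (1 + 2 * r), which is too small compared to r^2. *)
Lemma many_upper_primes : r < u.
Proof.
have b := le_upper_primes_log; have r0 := sqrt_ge.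
have b3 : n <= 3 * (x * (1 + r + u)) by lia.
rewrite ltnNge; apply/negP => ur.
have x1 : 0 < x by [].
have r1 : 9 * x < r by move: r0; rewrite -mulnn; nia.
have {b3} : n <= 3 * (x * (1 + r + r)).
  by apply: leq_trans b3 _; rewrite !leq_mul2l leq_add2l ur !orbT.
nia.
Qed.

(** Up to a relative error below 1 / (100 * x), |P| is at least n / (3 * x), so q is
    at most 6 * x up to an error below 1. *)
Lemma largest_prime_le (q : nat) : q * u <= 2 * n -> q <= 6 * x.
Proof.
move=> qu; have b := le_upper_primes_log; have r0 := sqrt_ge.
have b3 : n <= 3 * (x * (1 + r + u)) by lia.
rewrite leqNgt; apply/negP => q6.
have x1 : 0 < x by [].
have e1 : 300 * (x * x) * (1 + r) <= n.
  by apply: leq_trans rn; move: r0; rewrite -mulnn; nia.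
have e2 : q * n <= 3 * x * (q * (1 + r)) + 6 * x * n.
  apply: leq_trans (_ : q * (3 * (x * (1 + r + u))) <= _); first by rewrite leq_mul2l b3 orbT.
  have -> : q * (3 * (x * (1 + r + u))) = 3 * x * (q * (1 + r)) + 3 * x * (q * u) by ring.
  rewrite leq_add2l; have := leq_mul (leqnn (3 * x)) qu; lia.
have e3 : 100 * x * (q * n) <= q * n + 600 * (x * x) * n.
  apply: leq_trans (leq_mul (leqnn _) e2) _.
  have -> : 100 * x * (3 * x * (q * (1 + r)) + 6 * x * n) =
    q * (300 * (x * x) * (1 + r)) + 600 * (x * x) * n by ring.
  by rewrite leq_add2r leq_mul2l e1 orbT.
have n1 := n_gt0.
have e4 : 100 * x * q <= q + 600 * (x * x).
  by rewrite -(@leq_pmul2r n) // mulnDl -!mulnA; move: e3; rewrite -!mulnA.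
move: e4 x1; rewrite -(subnKC q6); move: (q - _) => d; move: x => y; clear.
rewrite !mulnDr; nia.
Qed.
End Growth.

(** * The arithmetic constraints are contradictory *)

Section Numeric.
Variable K : realFieldType.
Local Notation dens := (dens K).

Lemma Phi_bounds q x k : (size (primes_upto q) <= k)%N ->
  dens q * x%:R - 2 ^+ k <= ((Phi q x)%:R : K) <= dens q * x%:R + 2 ^+ k.
Proof.
move=> qk; have := sieve_bounds K x (primes_upto_prime q) (primes_upto_uniq q).
rewrite -densE -Phi_sieve.
have : 2 ^+ size (primes_upto q) <= 2 ^+ k :> K by rewrite ler_weXn2l // ler1n.
by move=> h /andP[h1 h2]; apply/andP; split; lra.
Qed.

Lemma pow2_9_le : 2 ^+ 9 <= 30 * 30 :> K.
Proof. rewrite !exprS expr0; lra. Qed.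

(** The sieve error for the nine primes below 29 is at most 2^9 <= 30^2, and the
    main terms have a relative margin of 1/30^2; beyond 30^6 the margin absorbs
    the error. *)
Definition large_bound : K := 30 * 30 * 30 * 30 * 30 * 30.

(** Here d is the density, N, n2, n3, nq stand for n, n/2, n/3, n/q, the f's for the
    numbers of rough integers up to these bounds, and E for the sieve error.  The
    two conclusions are the main terms of the number of rough m in (n/2, n] and of
    the contribution of the classes with m <= n/2. *)
Lemma rough_counts_lower (d N iq n2 n3 nq E f1 f2 f3 f4 : K) :
  0 < d <= 1 -> 0 <= E ->
  N / 2 - 1 <= n2 <= N / 2 -> N / 3 - 1 <= n3 -> nq <= N * iq ->
  d * N - E <= f1 -> d * n2 - E <= f2 <= d * n2 + E ->
  d * n3 - E <= f3 -> f4 <= d * nq + E ->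
  d * N / 2 - 2 * E <= f1 - f2 /\
  d * N * (8/3 - 2 * iq) - 6 - 8 * E <= 4 * f2 + 2 * f3 - 2 * f4.
Proof.
move=> /andP[d0 d1] E0 /andP[n2a n2b] n3a nqb h1 /andP[h2 h2'] h3 h4.
have m2 : d * (N / 2 - 1) <= d * n2 by rewrite ler_pM2l.
have m2' : d * n2 <= d * (N / 2) by rewrite ler_pM2l.
have m3 : d * (N / 3 - 1) <= d * n3 by rewrite ler_pM2l.
have mq : d * nq <= d * (N * iq) by rewrite ler_pM2l.
by split; lra.
Qed.

(** For s >= s0 the class estimates alone give more than n terms. *)
Lemma many_terms_contra (d N S s0 D B L E k : K) : 0 <= E -> E <= 30 * 30 -> large_bound <= N ->
  3 <= s0 <= 10 -> s0 <= S -> 0 <= D ->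
  d * N / 2 - 2 * E <= D -> d * N * k - 6 - 8 * E <= B ->
  S * D + B <= L -> L <= N -> 1 + 1/30/30 <= d * (s0 / 2 + k) -> False.
Proof.
rewrite /large_bound => E0 E9 N0 /andP[s03 s010] sS D0 hD hB hL LN h.
have m1 : s0 * D <= S * D by rewrite ler_wpM2r.
have m2 : s0 * (d * N / 2 - 2 * E) <= s0 * D by rewrite ler_pM2l; lra.
have m3 : s0 * E <= 10 * E by rewrite ler_wpM2r.
have N00 : 0 <= N by lra.
have m4 : (1 + 1/30/30) * N <= d * (s0 / 2 + k) * N by rewrite ler_wpM2r.
lra.
Qed.

(** For s <= s0 - 1 the class estimates contradict q * L <= 2 * n * s.  Since
    q * d <= 4, the difference between the two sides is monotone in s and only the
    extreme value s0 - 1 has to be checked. *)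
Lemma few_terms_contra (d q N S s0 D B L E k : K) : 0 <= E -> E <= 30 * 30 -> large_bound <= N ->
  3 <= S -> s0 <= 10 -> 4 <= s0 -> S <= s0 - 1 -> 5 <= q <= 25 -> q * d <= 4 ->
  d * N / 2 - 2 * E <= D -> d * N * k - 6 - 8 * E <= B ->
  S * D + B <= L -> q * L <= 2 * N * S ->
  2 * (s0 - 1) * (1 + 1/30/30) <= q * d * ((s0 - 1) / 2 + k) -> False.
Proof.
rewrite /large_bound => E0 E9 N0 S3 s010 s04 Ss0 /andP[q5 q25] qd hD hB hL qL h.
have N00 : 0 <= N by lra.
have m1 : S * (d * N / 2 - 2 * E) <= S * D by rewrite ler_pM2l; lra.
have m2 : q * (S * (d * N / 2 - 2 * E) + (d * N * k - 6 - 8 * E)) <= 2 * N * S.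
  by apply: le_trans qL; rewrite ler_pM2l; lra.
have m3 : q * (6 + 8 * E + 2 * (S * E)) <= 25 * (6 + 26 * E).
  have SE : S * E <= 9 * E by rewrite ler_wpM2r //; lra.
  apply: le_trans (_ : q * (6 + 26 * E) <= _); first by rewrite ler_pM2l; lra.
  by rewrite ler_wpM2r //; lra.
have m4 : N * (S * (2 - q * d / 2)) <= N * ((s0 - 1) * (2 - q * d / 2)).
  by rewrite ler_wpM2l // ler_wpM2r //; lra.
have m5 : N * (2 * (s0 - 1) * (1 + 1/30/30)) <= N * (q * d * ((s0 - 1) / 2 + k)).
  by rewrite ler_wpM2l.
have m6 : 3 * N <= (s0 - 1) * N by rewrite ler_wpM2r //; lra.
lra.
Qed.

(** The threshold s0 separates the two regimes; when s0 = 3 the second one is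
    empty because s >= 3. *)
Lemma no_data_from_5_to_23 n s q L (s0 : nat) :
  (5 <= q)%N -> multiplier_data n s q L -> (size (primes_upto q) <= 9)%N ->
  large_bound <= (n%:R : K) -> (q <= 25)%N -> (3 <= s0 <= 10)%N ->
  1 + 1/30/30 <= dens q * (s0%:R / 2 + (8/3 - 2 * q%:R^-1)) ->
  q%:R * dens q <= 4 ->
  (s0 = 3%N \/ 2 * (s0%:R - 1) * (1 + 1/30/30) <=
    q%:R * dens q * ((s0%:R - 1) / 2 + (8/3 - 2 * q%:R^-1))) -> False.
Proof.
move=> q5 [[qp s3 Ln qL] [_ _ /(_ q5) main]] qk nB q25 /andP[s03 s010] h1 h4 h2.
have E0 : 0 <= 2 ^+ 9 :> K by rewrite exprn_ge0.
have E9 := pow2_9_le; have bd x := Phi_bounds x qk.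
move: (2 ^+ 9) E0 E9 bd => E E0 E9 bd.
have d0 := dens_gt0 K q.
have d1 : dens q <= 1.
  by rewrite densE; case/andP: (density_bounds K (primes_upto_prime q)).
have d01 : 0 < dens q <= 1 by rewrite d0 d1.
have b2 := divn_bounds K n (isT : (0 < 2)%N).
have /andP[b3 _] := divn_bounds K n (isT : (0 < 3)%N).
have /andP[_ bq] := divn_bounds K n (prime_gt0 qp).
have /andP[f1 _] := bd n; have f2 := bd (n %/ 2)%N.
have /andP[f3 _] := bd (n %/ 3)%N; have /andP[_ f4] := bd (n %/ q)%N.
have [hD hB] := rough_counts_lower d01 E0 b2 b3 bq f1 f2 f3 f4.
have P2 : 0 <= (Phi q n)%:R - (Phi q (n %/ 2))%:R :> K.
  by rewrite subr_ge0 ler_nat !Phi_sieve sieve_le ?leq_div.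
have mainR : s%:R * ((Phi q n)%:R - (Phi q (n %/ 2))%:R) + (4 * (Phi q (n %/ 2))%:R +
   2 * (Phi q (n %/ 3))%:R - 2 * (Phi q (n %/ q))%:R) <= L%:R :> K.
  by move: main; rewrite -(ler_nat K) !natrD !natrM; clear; lra.
have s03R : 3 <= (s0%:R : K) <= 10 by rewrite (ler_nat _ 3) (ler_nat _ _ 10) s03.
case: (leqP s0 s) => ss.
  apply: (many_terms_contra E0 E9 nB s03R _ P2 hD hB mainR _ h1); rewrite ler_nat //.
  exact: ltnW.
case: h2 => [s0E|h2]; first by move: ss; rewrite s0E ltnNge s3.
apply: (few_terms_contra E0 E9 nB _ _ _ _ _ h4 hD hB mainR _ h2).
- by rewrite (ler_nat _ 3).
- by rewrite (ler_nat _ _ 10).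
- by rewrite (ler_nat _ 4); apply: leq_ltn_trans ss.
- by rewrite lerBrDr natr1 ler_nat.
- by rewrite (ler_nat _ 5) (ler_nat _ _ 25) q5.
by move: qL; rewrite -(ler_nat K) !natrM.
Qed.

Lemma Phi_le q x y : (x <= y)%N -> (Phi q x <= Phi q y)%N.
Proof. by rewrite !Phi_sieve; apply: sieve_le. Qed.

Lemma dens_list q l : primes_upto q = l -> dens q = \prod_(p <- l) (1 - p%:R^-1).
Proof. by rewrite densE /density => ->. Qed.

Lemma no_data_below_29 n s q L : multiplier_data n s q L -> large_bound <= (n%:R : K) ->
  (q < 29)%N -> False.
Proof.
move=> data nB q29.
have q0 : (q \in [:: 2; 3; 5; 7; 11; 13; 17; 19; 23])%N.
  suff : (q \in [seq p <- iota 0 29 | prime p])%N by [].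
  by rewrite mem_filter mem_iota q29; case: data => -[->].
move: q0; rewrite !inE.
have small23 : (q = 2 \/ q = 3)%N -> False.
  move=> q23; case: data => -[qp s3 Ln qL] [main2 main3 _].
  have E0 : 0 <= 2 ^+ 9 :> K by rewrite exprn_ge0.
  have qk : (size (primes_upto q) <= 9)%N by case: q23 => ->.
  have E9 := pow2_9_le; have bd x := Phi_bounds x qk.
  move: (2 ^+ 9) E0 E9 bd => E E0 E9 bd.
  have /andP[b2 b2'] := divn_bounds K n (isT : (0 < 2)%N).
  have /andP[_ b3] := divn_bounds K n (isT : (0 < 3)%N).
  have P2 : 0 <= (Phi q n)%:R - (Phi q (n %/ 2))%:R :> K.
    by rewrite subr_ge0 ler_nat Phi_le ?leq_div.
  have s3R : 3 <= s%:R :> K by rewrite (ler_nat _ 3).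
  have LR : L%:R <= n%:R :> K by rewrite ler_nat ltnW.
  have m := ler_wpM2r P2 s3R.
  have /andP[f1 f1'] := bd n; have /andP[f2 f2'] := bd (n %/ 2)%N.
  have /andP[f3 f3'] := bd (n %/ 3)%N.
  case: q23 => qE.
    have dE : dens q = 1/2 by rewrite (dens_list (l := [:: 2%N])) ?qE // big_seq1; lra.
    rewrite dE in f1 f1' f2 f2' f3 f3'; have main := main2 qE.
    have : s%:R * (Phi q n)%:R + 2 * (Phi q (n %/ 2))%:R <=
        L%:R + s%:R * (Phi q (n %/ 2))%:R :> K.
      by move: main; rewrite -(ler_nat K) !natrD !natrM; clear; lra.
    by rewrite /large_bound in nB; clear - nB E0 E9 b2 b2' m f1 f2 f2' LR; lra.
  have dE : dens q = 1/2 * (2/3).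
    by rewrite (dens_list (l := [:: 2; 3]%N)) ?qE // big_cons big_seq1; lra.
  rewrite dE in f1 f1' f2 f2' f3 f3'; have main := main3 qE.
  have : s%:R * (Phi q n)%:R + 4 * (Phi q (n %/ 2))%:R <=
      L%:R + s%:R * (Phi q (n %/ 2))%:R + (Phi q (n %/ 3))%:R :> K.
    by move: main; rewrite -(ler_nat K) !natrD !natrM; clear; lra.
  by rewrite /large_bound in nB; clear - nB E0 E9 b2 b2' b3 m f1 f2 f2' f3' LR; lra.
have go s0 l : (5 <= q)%N -> (q <= 25)%N -> (3 <= s0 <= 10)%N -> primes_upto q = l ->
  (size l <= 9)%N ->
  1 + 1/30/30 <= \prod_(p <- l) (1 - p%:R^-1) * (s0%:R / 2 + (8/3 - 2 * q%:R^-1)) :> K ->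
  q%:R * \prod_(p <- l) (1 - p%:R^-1) <= 4 :> K ->
  (s0 = 3%N \/ 2 * (s0%:R - 1) * (1 + 1/30/30) <=
    q%:R * \prod_(p <- l) (1 - p%:R^-1) * ((s0%:R - 1) / 2 + (8/3 - 2 * q%:R^-1)) :> K) -> False.
  move=> q5 q25 s0b lE lk; rewrite -(dens_list lE) => h1 h2 h3.
  by apply: no_data_from_5_to_23 data _ nB q25 s0b h1 h2 h3; rewrite ?lE.
case/or4P => [/eqP qE|/eqP qE|/eqP qE|].
- by apply: small23; left.
- by apply: small23; right.
- apply: (@go 3 [:: 2; 3; 5]%N); rewrite ?qE // ?big_cons ?big_nil;
    [lra|lra|by left].
case/or4P => [/eqP qE|/eqP qE|/eqP qE|].
- apply: (@go 4 [:: 2; 3; 5; 7]%N); rewrite ?qE // ?big_cons ?big_nil;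
    [lra|lra|right; lra].
- apply: (@go 5 [:: 2; 3; 5; 7; 11]%N); rewrite ?qE // ?big_cons ?big_nil;
    [lra|lra|right; lra].
- apply: (@go 6 [:: 2; 3; 5; 7; 11; 13]%N); rewrite ?qE // ?big_cons ?big_nil;
    [lra|lra|right; lra].
case/or3P => /eqP qE.
- apply: (@go 6 [:: 2; 3; 5; 7; 11; 13; 17]%N); rewrite ?qE // ?big_cons ?big_nil;
    [lra|lra|right; lra].
- apply: (@go 7 [:: 2; 3; 5; 7; 11; 13; 17; 19]%N); rewrite ?qE // ?big_cons ?big_nil;
    [lra|lra|right; lra].
- apply: (@go 8 [:: 2; 3; 5; 7; 11; 13; 17; 19; 23]%N); rewrite ?qE // ?big_cons ?big_nil;
    [lra|lra|right; lra].
Qed.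

(** Of six consecutive integers starting at a positive multiple of 6 only the
    second and the last can be prime. *)
Lemma count_block b j : (0 < b)%N -> (count prime (iota (6 * b) (6 * j)) <= 2 * j)%N.
Proof.
move=> b0; elim: j => [|j IHj]; first by rewrite muln0.
have -> : (6 * j.+1 = 6 * j + 6)%N by lia.
rewrite iotaD count_cat; have -> : (2 * j.+1 = 2 * j + 2)%N by lia.
apply: leq_add => //; set m := (6 * b + 6 * j)%N.
have even_np x : (x = 2 * (3 * (b + j)) \/ x = 2 * (3 * (b + j) + 1) \/
    x = 2 * (3 * (b + j) + 2))%N -> prime x = false.
  move=> xE; apply/negP => /even_prime[x2|]; first by lia.
  by case: xE => [|[|]] ->; rewrite mul2n odd_double.
have -> /= : iota m 6 = [:: m; m.+1; m.+2; m.+3; m.+4; m.+4.+1]%N by [].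
have e0 := @even_np m; have e2 := @even_np m.+2; have e4 := @even_np m.+4.
rewrite e0 ?e2 ?e4; try (rewrite /m; lia).
have -> : prime m.+3 = false.
  apply/negP => mp; have d3 : (3 %| m.+3)%N.
    have -> : m.+3 = ((2 * (b + j) + 1) * 3)%N by rewrite /m; lia.
    exact: dvdn_mull.
  by move: d3; rewrite dvdn_prime2 // => /eqP; rewrite /m; lia.
by case: (prime _); case: (prime _).
Qed.

Lemma size_primes_upto6 a : (0 < a)%N -> (size (primes_upto (6 * a)) <= 2 * a + 1)%N.
Proof.
move=> a0; rewrite /primes_upto size_filter.
have -> : ((6 * a).+1 = 6 + (6 * a.-1 + 1))%N by lia.
rewrite (iotaD 0 6) (iotaD _ (6 * a.-1) 1) !count_cat.
have c0 : count prime (iota 0 6) = 3%N by [].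
have h := @count_block 1 a.-1 isT; rewrite muln1 in h.
have c1 : count prime (iota (0 + 6 + 6 * a.-1) 1) = 0%N.
  have -> : (0 + 6 + 6 * a.-1 = 6 * a)%N by lia.
  rewrite /= addn0; apply/eqP; rewrite eqb0; apply/negP => /even_prime[|]; first by lia.
  by rewrite (_ : 6 * a = (3 * a).*2)%N ?odd_double //; lia.
rewrite c0 c1 addn0; apply: (@leq_trans (3 + 2 * a.-1)); last by lia.
by rewrite leq_add2l.
Qed.

Lemma size_primes_upto_le q z : (q <= z)%N -> (size (primes_upto q) <= size (primes_upto z))%N.
Proof.
move=> qz; rewrite /primes_upto !size_filter.
have -> : z.+1 = (q.+1 + (z - q))%N by lia.
by rewrite iotaD count_cat leq_addr.
Qed.

(** For large q the contribution of the classes with m <= n/2 can be dropped: s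
    times the number of rough m in (n/2, n] is at most L, and q * L <= 2 * n * s. *)
Lemma rough_gap_le n s q L : (29 <= q)%N -> multiplier_data n s q L ->
  (q * (Phi q n - Phi q (n %/ 2)) <= 2 * n)%N.
Proof.
move=> q29 [[qp s3 Ln qL] [_ _ main]].
have {}main := main (leq_trans _ q29).
have le1 : (Phi q (n %/ q) <= Phi q (n %/ 3))%N.
  by apply: Phi_le; apply: leq_div2l => //; apply: leq_trans q29.
have le2 : (Phi q (n %/ 2) <= Phi q n)%N by apply: Phi_le; apply: leq_div.
have sG : (s * (Phi q n - Phi q (n %/ 2)) <= L)%N.
  by rewrite mulnBr; move: (main isT) le1; clear; lia.
rewrite -(@leq_pmul2l s); last by lia.
rewrite mulnCA; apply: leq_trans (leq_mul (leqnn q) sG) _.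
by rewrite mulnC [(s * _)%N]mulnC // mulnC.
Qed.

(** The number of q-rough m in (n/2, n] is about dens q * n / 2, and
    q * dens q / 2 >= 9/4 > 2. *)
Lemma rough_gap_medium_q n q k : (29 <= q)%N -> (size (primes_upto q) <= k)%N ->
  (8 * q * 2 ^ k < n)%N -> (2 * n < q * (Phi q n - Phi q (n %/ 2)))%N.
Proof.
move=> q29 qk nk.
have P2 : (Phi q (n %/ 2) <= Phi q n)%N by apply: Phi_le; apply: leq_div.
rewrite -(ltr_nat K) !natrM natrB //.
have := ltr_nat K (8 * q * 2 ^ k) n; rewrite nk !natrM natrX => nkR.
have /andP[b2 b2'] := divn_bounds K n (isT : (0 < 2)%N).
have /andP[f1 _] := Phi_bounds n qk; have /andP[_ f2] := Phi_bounds (n %/ 2) qk.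
have d0 := dens_gt0 K q; have dq := dens_mul_ge K q29.
have m2 := ler_wpM2l (ltW d0) b2'.
have q0 : 0 < q%:R :> K by rewrite ltr0n; lia.
move: (Phi q n)%:R (Phi q (n %/ 2))%:R f1 f2 => F1 F2 f1 f2.
have h : q%:R * (dens q * (n%:R / 2) - 2 * 2 ^+ k) <= q%:R * (F1 - F2).
  by rewrite ler_pM2l //; lra.
apply: lt_le_trans h.
have m3 : 9 / 2 * n%:R <= q%:R * dens q * n%:R by rewrite ler_wpM2r.
lra.
Qed.
Definition primes_between z q := [seq p <- iota z.+1 (q - z) | prime p].

Lemma primes_upto_split z q : (z <= q)%N ->
  primes_upto q = primes_upto z ++ primes_between z q.
Proof.
move=> zq; rewrite /primes_upto /primes_between -filter_cat.
have -> : q.+1 = (z.+1 + (q - z))%N by rewrite addSn subnKC.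
by rewrite iotaD.
Qed.

Lemma sieve_catC s t x : sieve (s ++ t) x = sieve (t ++ s) x.
Proof.
by rewrite /sieve; apply: eq_count => m; rewrite /sfree !all_cat andbC.
Qed.

Lemma size_primes_between a q : (0 < a)%N -> (6 * a <= q)%N ->
  (3 * size (primes_between (6 * a) q) <= q - 6 * a + 6)%N.
Proof.
move=> a0 aq; rewrite /primes_between size_filter; set d := (q - 6 * a)%N.
pose j := (d %/ 6).+1.
have dj : (d + 1 <= 6 * j)%N by rewrite /j; have := ltn_ceil d (isT : (0 < 6)%N); lia.
have h := count_block j a0.
have : (count prime (iota (6 * a).+1 d) <= count prime (iota (6 * a) (6 * j)))%N.
  have -> : (6 * j = 1 + (d + (6 * j - 1 - d)))%N by lia.
  rewrite (iotaD _ 1) count_cat (iotaD _ d) count_cat addn1.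
  by rewrite addnCA leq_addr.
have : (3 * (2 * j) <= d + 6)%N by rewrite /j; have := leq_divM d 6; lia.
by move=> h2 h1; apply: leq_trans h2; rewrite leq_mul2l; apply: leq_trans h1 h.
Qed.

Lemma sieve_diff_le n z p k : (size (primes_upto z) <= k)%N -> (z < p)%N -> (0 < z)%N ->
  ((sieve (primes_upto z) (n %/ p) - sieve (primes_upto z) (n %/ 2 %/ p))%N)%:R <=
  dens z * n%:R / 2 / z%:R + 2 + 2 * 2 ^+ k :> K.
Proof.
move=> zk zp z0; have p0 : (0 < p)%N by lia.
rewrite natrB; last by apply: sieve_le; apply/leq_div2r/leq_div.
rewrite -!Phi_sieve.
have /andP[_ h1] := Phi_bounds (n %/ p) zk.
have /andP[h2 _] := Phi_bounds (n %/ 2 %/ p) zk.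
have /andP[_ e1] := divn_bounds K n p0.
have /andP[e2 _] := divn_bounds K (n %/ 2) p0.
have /andP[e3 _] := divn_bounds K n (isT : (0 < 2)%N).
have d0 := dens_gt0 K z.
have d1 : dens z <= 1.
  by rewrite densE; case/andP: (density_bounds K (primes_upto_prime z)).
have p1 : 1 <= p%:R :> K by rewrite ler1n.
have ip0 : 0 < p%:R^-1 :> K by rewrite invr_gt0; lra.
have ip1 : p%:R^-1 <= 1 :> K by rewrite invf_le1 //; lra.
have iz : p%:R^-1 <= z%:R^-1 :> K.
  by rewrite lef_pV2 ?posrE ?ltr0n // ler_nat ltnW.
have g1 := ler_wpM2l (ltW d0) e1; have g2 := ler_wpM2l (ltW d0) e2.
have g3 := ler_wpM2r (ltW ip0) e3.
have g4 := ler_wpM2l (ltW d0) g3.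
have n0 : 0 <= n%:R :> K by [].
have g5 : dens z * n%:R * p%:R^-1 <= dens z * n%:R * z%:R^-1.
  by rewrite ler_wpM2l // mulr_ge0 // ltW.
have g6 : dens z * p%:R^-1 <= 1 by apply: mulr_ile1 => //; exact: ltW.
lra.
Qed.

(** 6 * a is composite, so its density is the one at 6 * a - 1, an odd number. *)
Lemma dens_mul6_ge a : (47 <= a)%N -> 14 <= 6 * a%:R * dens (6 * a).
Proof.
move=> a47; have a47R : 47 <= a%:R :> K by rewrite (ler_nat _ 47).
have E : (6 * a = (2 * (3 * a - 1) + 1).+1)%N by lia.
have np : prime (6 * a) = false.
  apply/negP => /even_prime[|]; first by lia.
  by rewrite (_ : 6 * a = (3 * a).*2)%N ?odd_double //; lia.
have dE : dens (6 * a) = dens (2 * (3 * a - 1) + 1) by rewrite {1}E densS -E np.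
have := @dens_sqr_ge K (3 * a - 1) _; rewrite -dE => /(_ ltac:(lia)).
have -> : (2 * (3 * a - 1) + 1)%N%:R = 6 * a%:R - 1 :> K.
  rewrite (_ : 6 * a%:R = ((2 * (3 * a - 1) + 1).+1)%:R); last by rewrite -E natrM.
  by rewrite -natr1 addrK.
have := dens_gt0 K (6 * a); move: (dens _) => d d0 h.
rewrite leNgt; apply/negP => lt14.
have z0 : 0 <= 6 * a%:R * d by rewrite mulr_ge0 // ?mulr_ge0 // ltW.
have sq : (6 * a%:R * d) * (6 * a%:R * d) <= 14 * 14 by rewrite ler_pM // ltW.
have h2 : 18/25 * (6 * a%:R) <= (6 * a%:R) * d ^+ 2 * (6 * a%:R).
  by rewrite ler_wpM2r //; [rewrite mulr_ge0|have := exprn_gt0 2 d0; nra].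
rewrite expr2 in h2; lra.
Qed.

(** The primes in (z, q], t many, remove at most the fraction t / z <= 59/100 of
    the z-rough integers in (n/2, n].  At least 41/100 of dens z * n / 2 remain, and
    multiplying by q >= z gives more than 14 * 41/200 * n > 2 * n, up to sieve errors.
    The bound t + 1 <= 4 * a only serves to control these. *)
Lemma gap_after_union_bound (z d q t a E N n2 F1 F2 G1 G2 : K) :
  14 <= z * d -> z <= q -> 100 * t <= 59 * z -> t + 1 <= 4 * a -> 0 <= E -> 0 < N ->
  d * N - E <= F1 -> F2 <= d * n2 + E -> d * n2 <= d * (N / 2) ->
  F1 - F2 <= G1 - G2 + t * (d * N / 2 / z + 2 + 2 * E) ->
  2 * (q * (4 * a) * (2 + 2 * E)) <= N -> 0 <= z -> 0 < d -> 0 <= t ->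
  2 * N < q * (G1 - G2).
Proof.
move=> zd zq tz ta E0 N0 f1 f2 m2 main nk z0 d0 t0.
have z1 : 0 < z by rewrite lt_def z0 andbT; apply/eqP => z00; rewrite z00 mul0r in zd; lra.
have q0 : 0 < q by lra.
have w0 : 0 <= d * N / 2 / z by rewrite !mulr_ge0 ?invr_ge0 // ltW.
have zw : z * (d * N / 2 / z) = d * N / 2 by field; lra.
move: (d * N / 2 / z) w0 zw main => w w0 zw main.
have tw : 100 * (t * w) <= 59 * (d * N / 2).
  by rewrite -zw !mulrA ler_wpM2r.
have tE : (t + 1) * (2 + 2 * E) <= 4 * a * (2 + 2 * E) by rewrite ler_wpM2r //; lra.
have G : 41 / 200 * (d * N) - 4 * a * (2 + 2 * E) <= G1 - G2 by lra.
have qG : q * (41 / 200 * (d * N) - 4 * a * (2 + 2 * E)) <= q * (G1 - G2).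
  by rewrite ler_pM2l.
have qd : 14 * N <= q * d * N.
  by rewrite ler_pM2r //; apply: le_trans zd _; rewrite ler_pM2r.
lra.
Qed.

(** Sieving up to q directly would cost an error 2^k with k the number of primes
    up to q, which may exceed n.  So the sieve stops at z = 6 * a and the primes in
    (z, q] are handled by the union bound. *)
Lemma rough_gap_large_q n q a k : (47 <= a)%N -> (6 * a < q)%N -> (q <= 16 * a + 20)%N ->
  (size (primes_upto (6 * a)) <= k)%N ->
  (2 * (q * (4 * a) * (2 + 2 * 2 ^ k)) <= n)%N -> (0 < n)%N ->
  (2 * n < q * (Phi q n - Phi q (n %/ 2)))%N.
Proof.
move=> a47 aq qa zk nk n0; set z := (6 * a)%N in aq zk *.
have a0 : (0 < a)%N by lia.
set t := primes_between z q.
have tz : (3 * size t <= q - z + 6)%N by apply: size_primes_between => //; apply: ltnW.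
have qE : primes_upto q = primes_upto z ++ t by apply/primes_upto_split/ltnW.
have P2 x : (Phi x (n %/ 2) <= Phi x n)%N by apply: Phi_le; apply: leq_div.
have uts : uniq (t ++ primes_upto z) by rewrite uniq_catC -qE primes_upto_uniq.
have := sieve_cat_ge (filter_all _ _ : all prime t) (primes_upto_prime z) uts (leq_div n 2).
rewrite !(sieve_catC t) -qE -!Phi_sieve => main.
have {}main : (Phi z n - Phi z (n %/ 2) <= (Phi q n - Phi q (n %/ 2)) +
    \sum_(p <- t) (sieve (primes_upto z) (n %/ p) -
                   sieve (primes_upto z) (n %/ 2 %/ p)))%N.
  move: main (P2 z) (P2 q).
  move: (\sum_(p <- t) _)%N => S; clear; lia.
have d0 := dens_gt0 K z.
set c := dens z * n%:R / 2 / z%:R + 2 + 2 * 2 ^+ k.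
have sumle : (\sum_(p <- t) (sieve (primes_upto z) (n %/ p) -
                   sieve (primes_upto z) (n %/ 2 %/ p)))%N%:R <= (size t)%:R * c :> K.
  rewrite natr_sum -sum1_size natr_sum mulr_suml !big_seq; apply: ler_sum => p.
  rewrite mem_filter mem_iota mul1r => /andP[pp /andP[zp _]].
  by apply: sieve_diff_le => //; rewrite muln_gt0.
have mainR : (Phi z n)%:R - (Phi z (n %/ 2))%:R <=
    (Phi q n)%:R - (Phi q (n %/ 2))%:R + (size t)%:R * c :> K.
  apply: le_trans (_ : (Phi q n)%:R - (Phi q (n %/ 2))%:R + _ <= _);
    last by rewrite lerD2l; exact: sumle.
  by rewrite -!natrB // -natrD ler_nat.
rewrite -(ltr_nat K) !natrM natrB //.
have /andP[_ b2'] := divn_bounds K n (isT : (0 < 2)%N).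
have /andP[f1 _] := Phi_bounds n zk; have /andP[_ f2] := Phi_bounds (n %/ 2) zk.
have m2 := ler_wpM2l (ltW d0) b2'.
move: (Phi q n)%:R (Phi q (n %/ 2))%:R mainR => G1 G2 mainR.
move: (Phi z n)%:R (Phi z (n %/ 2))%:R f1 f2 mainR => F1 F2 f1 f2 mainR.
have E0 : 0 <= 2 ^+ k :> K by rewrite exprn_ge0.
have nkR : 2 * (q%:R * (4 * a%:R) * (2 + 2 * 2 ^+ k)) <= n%:R :> K.
  by move: nk; rewrite -(ler_nat K) !(natrM, natrD, natrX).
have zR : z%:R = 6 * a%:R :> K by rewrite natrM.
have a47R : 47 <= a%:R :> K by rewrite (ler_nat _ 47).
have zd : 14 <= z%:R * dens z by rewrite zR; apply: dens_mul6_ge.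
have qzR : z%:R <= q%:R :> K by rewrite ler_nat ltnW.
have tR : 100 * (size t)%:R <= 59 * z%:R :> K.
  by rewrite -!natrM ler_nat; move: tz qa; rewrite /z; clear - a47; lia.
have tR' : (size t)%:R + 1 <= 4 * a%:R :> K.
  by rewrite -natrM natr1 ler_nat; move: tz qa; rewrite /z; clear - a47; lia.
have nR : 0 < n%:R :> K by rewrite ltr0n.
by apply: (gap_after_union_bound zd qzR tR tR' E0 nR f1 f2 m2 mainR nkR).
Qed.

End Numeric.

(** * Conclusion *)

Section Conclusion.
Local Open Scope nat_scope.

(** For q >= 29 put a = 3l/8.  There are at most 2 * a + 1 primes up to 6 * a, so
    sieving up to 6 * a costs an error 2^(2a + 1), about 2^(3l/4).  The
    remaining factor 2^t with t = l - 2a >= 32 absorbs all polynomial factors in l.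
    Beyond 6 * a, q is still at most 6 * (l + 1) <= 16 * a + 20. *)
Lemma no_multiplier_data (K : realFieldType) n l r s q L : 127 <= l -> 2 ^ l <= n ->
  n < 2 ^ l.+1 -> r * r <= n -> n < r.+1 * r.+1 ->
  s * size (upper_primes n) <= L -> multiplier_data n s q L -> False.
Proof.
move=> l127 nl nl' rn nr sP data.
have [[qp s3 Ln qL] _] := data.
have qu : q * size (upper_primes n) <= 2 * n.
  rewrite -(@leq_pmul2r s); last by lia.
  by apply: leq_trans qL; rewrite -mulnA leq_mul2l [_ * s]mulnC sP orbT.
have q6 := largest_prime_le l127 nl nl' rn nr qu.
have n0 := n_gt0 nl.
have [q29|q29] := ltnP q 29.
  apply: (no_data_below_29 (K := K) data) q29; rewrite /large_bound.
  have : 30 * 30 * 30 * 30 * 30 * 30 <= n.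
    have h u : 30 <= u -> 30 * 30 * 30 * 30 * 30 * 30 <= u ^ 6.
      move=> h; rewrite !expnS expn0 muln1 !mulnA.
      exact: leq_mul (leq_mul (leq_mul (leq_mul (leq_mul h h) h) h) h) h.
    apply: leq_trans (h (2 ^ 5) isT) _; rewrite -expnM.
    apply: leq_trans nl; rewrite leq_exp2l; last by [].
    exact: (@leq_trans 127).
  by rewrite -(ler_nat K) !natrM; apply.
pose a := 3 * l %/ 8; pose t := l - 2 * a.
have a8 : 8 * a <= 3 * l < 8 * a + 8 by rewrite /a; clear; lia.
have a47 : 47 <= a by clear - a8 l127; lia.
have t32 : 32 <= t by rewrite /t; clear - a8 l127; lia.
have ta : 2 * a <= 3 * t by rewrite /t; clear - a8; lia.
have a0 : 0 < a by clear - a47; lia.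
have lE : 2 ^ l = 2 ^ (2 * a) * 2 ^ t by rewrite -expnD /t subnKC //; clear - a8; lia.
have tt : 100 * 100 * (t * t) <= 2 ^ t by have := sqr_lt_exp (t - 32); rewrite subnKC.
have sz := size_primes_upto6 a0.
have gap := rough_gap_le q29 data.
(* n >= 2^(2a) * 2^t and 2^t exceeds any such quadratic quantity *)
have bnd c : c <= 100 * 100 * (t * t) -> c * 2 ^ (2 * a) <= n.
  move=> ct; apply: leq_trans nl; rewrite lE mulnC leq_mul2l.
  by rewrite (leq_trans ct tt) orbT.
have k1 : 2 ^ (2 * a + 1) = 2 * 2 ^ (2 * a) by rewrite addn1 expnS.
case: (leqP q (6 * a)) => qa.
  have qk : size (primes_upto q) <= 2 * a + 1.
    exact: leq_trans (size_primes_upto_le qa) sz.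
  have : 2 * n < q * (Phi q n - Phi q (n %/ 2)).
    apply: (rough_gap_medium_q K q29 qk).
    apply: leq_trans (bnd (16 * q + 1) _); last first.
      by clear - qa ta t32; nia.
    by rewrite k1 mulnDl mul1n; have := expn_gt0 2 (2 * a); clear; nia.
  by rewrite ltnNge gap.
have : 2 * n < q * (Phi q n - Phi q (n %/ 2)).
  apply: (rough_gap_large_q K a47 qa _ sz _ n0); first by clear - q6 a8; lia.
  apply: leq_trans (bnd (48 * (q * a)) _); last first.
    have q25 : q <= 25 * t by clear - q6 a8 ta t32; lia.
    have := leq_mul q25 ta; clear; nia.
  rewrite k1; have := expn_gt0 2 (2 * a); move: (2 ^ (2 * a)) => u; clear; nia.
by rewrite ltnNge gap.
Qed.

Theorem wt_segmentM_ge n (A : R) : 2 ^ 127 <= n -> A != 0%R -> n <= wt (segment n * A)%R.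
Proof.
move=> n127 A0.
have n1 : 1 < n.
  by apply: leq_trans n127; rewrite -[X in X < _](expn0 2) ltn_exp2l.
have n0 : 0 < n by apply: ltnW.
pose l := trunc_log 2 n.
have /andP[nl nl'] := trunc_log_bounds (isT : 1 < 2) n0.
have l127 : 127 <= l by rewrite /l trunc_log_max.
have [r [rn nr]] := exists_sqrt n.
have up p : p \in upper_primes n -> [/\ prime p, p <= n & n < 2 * p].
  rewrite mem_filter mem_iota => /andP[pp /andP[p1 p2]]; split=> //.
    by move: p2; clear; lia.
  by move: p1; clear; lia.
have szE : size [seq to_pos p | p <- upper_primes n] = size (upper_primes n) by rewrite size_map.
apply: (@weight_bound n r [seq to_pos p | p <- upper_primes n]) => //.
- rewrite map_inj_in_uniq ?filter_uniq ?iota_uniq // => p p' /up[pp _ _] /up[pp' _ _].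
  by move/(congr1 pval); rewrite !to_posE ?prime_gt0.
- by move=> x /mapP[p /up[pp pn np] ->]; rewrite to_posE ?prime_gt0.
- by rewrite szE; apply: (many_upper_primes l127 nl nl' rn nr).
move=> s q L; rewrite szE; exact: (no_multiplier_data rat l127 nl nl' rn nr).
Qed.

(** The exponents of the monomials of f * B that survive modulo 2 are exactly the
    integers lying in an odd number of dilates. *)
Lemma wt_le_symdiff_dilates n (A : {fset nat}) : {in A, forall a, 0 < a} ->
  wt (segment n * \sum_(a <- A) mono (to_pos a))%R <= #|` symdiff_dilates n A|.
Proof.
move=> A0; set B := (\sum_(a <- A) mono (to_pos a))%R.
have mB x : (x \in supp B) = (pval x \in A).
  rewrite /B -(big_map to_pos xpredT mono) mem_sum_mono /=; last first.
    rewrite map_inj_in_uniq ?fset_uniq // => a b aA bA /(congr1 pval).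
    by rewrite !to_posE ?A0.
  apply/mapP/idP => [[a aA ->]|xA]; first by rewrite to_posE ?A0.
  by exists (pval x); rewrite ?to_posK.
set FB := (segment n * B)%R.
have <- : #|` [fset pval x | x in supp FB]| = wt FB.
  by rewrite card_imfset //; apply: val_inj.
apply: fsubset_leq_card; rewrite /FB.
apply/fsubsetP => y /imfsetP[x /= xFB ->].
rewrite in_symdiff_dilates; move: xFB; rewrite /segment mulr_suml mem_sum.
congr (is_true (odd _)); rewrite -sum1_count [RHS]big_mkcond big_seq [RHS]big_seq.
apply: eq_bigr => k; rewrite mem_iota => /andP[k0 _].
suff -> : (x \in supp (mono (to_pos k) * B)%R) = (pval x \in dilate k A) by [].
apply/idP/imfsetP => [/mem_monoM_inv[z zB ->]|[a /= aA xE]].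
  by move: zB; rewrite mB => zA; exists (pval z); rewrite //= to_posE.
have -> : x = pmul (to_pos k) (to_pos a).
  by apply: val_inj; rewrite /= xE (to_posE k0) (to_posE (A0 _ aA)).
by rewrite mem_monoM mB to_posE ?A0.
Qed.

Lemma threshold_ge : 2 ^ 127 <= 2 * (3 ^ 80 - 321).
Proof. lia. Qed.

End Conclusion.

Theorem theorem1p2 :
  exists2 N : nat, N = (2 * (3 ^ 80 - 321))%N &
    forall (n : nat) (A : {fset nat}),
      (N <= n)%N -> A != fset0 -> {in A, forall a : nat, (0 < a)%N} ->
      (n <= #|` symdiff_dilates n A|)%N.
Proof.
exists (2 * (3 ^ 80 - 321))%N => // n A Nn A_neq0 A_pos.
apply: leq_trans (wt_le_symdiff_dilates n A_pos); apply: wt_segmentM_ge.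
  exact: leq_trans threshold_ge Nn.
have [a aA] := fset0Pn _ A_neq0; rewrite -wt_gt0 -(big_map to_pos xpredT mono).
rewrite wt_sum_mono ?size_map; first by rewrite cardfs_gt0.
rewrite map_inj_in_uniq ?fset_uniq // => b c bA cA /(congr1 pval).
by rewrite !to_posE ?A_pos.
Qed.
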